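(* For $\delta>0$, let $L_\delta$ be the smallest integer with $L_\delta\ge-1$ and $\frac{p_{L_\delta+2}}{p_{L_\delta+2}-1}\le1+\delta$. Then $L_\delta$ and the constant $\Psi(L_\delta)$ can be computed by an algorithm with time complexity $o(1/\delta)$ as $\delta\to0$.
   Context: $p_i$ denotes the $i$-th prime indexed from $0$ ($p_0=2,p_1=3,\dots$), and $\Psi(n)=\prod_{i=0}^{n+1}\frac{p_i}{p_i-1}$ for integers $n\ge-1$. *)

(* Defs.v *)
From HB Require Import structures.
From mathcomp Require Import all_boot all_order all_algebra.
From mathcomp Require Import all_classical all_reals all_analysis.
Import Order.TTheory GRing.Theory Num.Theory.
Import numFieldNormedType.Exports.

Set Implicit Arguments.
Unset Strict Implicit.
Unset Printing Implicit Defensive.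

Local Open Scope ring_scope.

Lemma next_prime_ex (n : nat) : exists p : nat, (n < p)%N && prime p.
Proof. by have [p lt_np pr_p] := prime_above n; exists p; rewrite lt_np. Qed.

Definition next_prime (n : nat) : nat := ex_minn (next_prime_ex n).

Fixpoint nth_prime (i : nat) : nat :=
  if i is j.+1 then next_prime (nth_prime j) else 2%N.

Definition prime_ratio (R : realType) (i : nat) : R :=
  (nth_prime i)%:R / ((nth_prime i)%:R - 1).

(* Only meaningful for -1 <= n, where absz (n + 2) is n + 2: the product has the
   n + 2 factors of index 0, ..., n + 1. *)
Definition Psi (R : realType) (n : int) : R :=
  \prod_(0 <= i < absz (n + 2)) prime_ratio R i.

Definition L_admissible (R : realType) (delta : R) (n : int) : Prop :=
  -1 <= n /\ prime_ratio R (absz (n + 2)) <= 1 + delta.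

Definition is_L (R : realType) (delta : R) (L : int) : Prop :=
  L_admissible delta L /\ forall n : int, L_admissible delta n -> L <= n.

(* Model of computation: the real RAM.  There are two random-access memories,
   one of machine integers and one of exact real numbers.  Every elementary
   operation or comparison takes one unit of time.  Machine integers are bounded
   by a word bound W (see [word_bound]).  Programs contain integer constants only,
   integers can be converted to reals, and there is no rounding or floor operation
   from reals to integers: reals influence integers only through comparisons. *)

(* [Ind a] designates the cell whose address is stored in integer cell [a]. *)
Inductive loc : Type := Dir of nat | Ind of nat.

Inductive iarg : Type := IConst of int | ICell of loc.

Inductive iop : Type := IAdd | ISub | IMul | IDiv | IMod.

Inductive rop : Type := RAdd | RSub | RMul | RDiv.

Inductive cmp : Type := CLe | CLt | CEq.

Inductive instr : Type :=
| ISet of loc & iarg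
| IOp of loc & iop & iarg & iarg
| RSet of loc & loc
| ROfInt of loc & iarg
| ROp of loc & rop & loc & loc.

Inductive test : Type :=
| ITest of cmp & iarg & iarg
| RTest of cmp & loc & loc.

Inductive prog : Type :=
| Skip
| Do of instr
| Seq of prog & prog
| If of test & prog & prog
| While of test & prog.

Record state (R : realType) : Type :=
  State { imem : nat -> int; rmem : nat -> R }.

Definition upd (A : Type) (m : nat -> A) (k : nat) (v : A) : nat -> A :=
  fun j => if j == k then v else m j.

Section Semantics.
Variables (R : realType) (W : nat).
Implicit Types (s : state R).

(* [None] stands for a run-time error: a negative address, a division by zero,
   or an integer result exceeding the word bound. *)
Definition addr s (l : loc) : option nat :=
  match l with
  | Dir a => Some a
  | Ind a => if imem s a is Posz k then Some k else None
  end.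

Definition iread s (x : iarg) : option int :=
  match x with
  | IConst c => Some c
  | ICell l => omap (imem s) (addr s l)
  end.

Definition rread s (l : loc) : option R := omap (rmem s) (addr s l).

Definition iwrite s (l : loc) (v : int) : option (state R) :=
  if (absz v <= W)%N then
    omap (fun k => State (upd (imem s) k v) (rmem s)) (addr s l)
  else None.

Definition rwrite s (l : loc) (v : R) : option (state R) :=
  omap (fun k => State (imem s) (upd (rmem s) k v)) (addr s l).

Definition iapply (o : iop) (x y : int) : option int :=
  match o with
  | IAdd => Some (x + y)
  | ISub => Some (x - y)
  | IMul => Some (x * y)
  | IDiv => if y == 0 then None else Some (x %/ y)%Z
  | IMod => if y == 0 then None else Some (x %% y)%Z
  end.

Definition rapply (o : rop) (x y : R) : option R :=
  match o with
  | RAdd => Some (x + y)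
  | RSub => Some (x - y)
  | RMul => Some (x * y)
  | RDiv => if y == 0 then None else Some (x / y)
  end.

Definition compare_with (K : numDomainType) (c : cmp) (x y : K) : bool :=
  match c with CLe => x <= y | CLt => x < y | CEq => x == y end.

Definition bind2 (A B C : Type) (f : A -> B -> option C)
    (x : option A) (y : option B) : option C :=
  obind (fun a => obind (f a) y) x.

Definition run_instr s (i : instr) : option (state R) :=
  match i with
  | ISet l x => obind (iwrite s l) (iread s x)
  | IOp l o x y =>
      obind (iwrite s l) (bind2 (iapply o) (iread s x) (iread s y))
  | RSet l x => obind (rwrite s l) (rread s x)
  | ROfInt l x => obind (fun v : int => rwrite s l v%:~R) (iread s x)
  | ROp l o x y =>
      obind (rwrite s l) (bind2 (rapply o) (rread s x) (rread s y))
  end.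

Definition run_test s (b : test) : option bool :=
  match b with
  | ITest c x y =>
      bind2 (fun u v => Some (compare_with c u v)) (iread s x) (iread s y)
  | RTest c x y =>
      bind2 (fun u v => Some (compare_with c u v)) (rread s x) (rread s y)
  end.

(* [exec s p t s']: started in [s], the program [p] halts without error in [s']
   after exactly [t] instructions and tests.  The relation is deterministic. *)
Inductive exec : state R -> prog -> nat -> state R -> Prop :=
| exec_skip s : exec s Skip 0 s
| exec_do s i s' : run_instr s i = Some s' -> exec s (Do i) 1 s'
| exec_seq s p t s1 q u s2 :
    exec s p t s1 -> exec s1 q u s2 -> exec s (Seq p q) (t + u)%N s2
| exec_if s b c p q t s' :
    run_test s b = Some c -> exec s (if c then p else q) t s' ->
    exec s (If b p q) t.+1 s'
| exec_while_done s b p :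
    run_test s b = Some false -> exec s (While b p) 1 s
| exec_while_step s b p t s1 u s2 :
    run_test s b = Some true -> exec s p t s1 -> exec s1 (While b p) u s2 ->
    exec s (While b p) (t + u).+1 s2.

End Semantics.

(* The input is in real cell 0; every other cell holds 0. *)
Definition init_state (R : realType) (x : R) : state R :=
  State (fun=> 0) (upd (fun=> 0) 0%N x).

(* Words of O(log (1 / delta)) bits as delta tends to 0. *)
Definition word_bound (R : realType) (c : nat) (delta : R) : nat :=
  (c * (Num.truncn delta^-1).+1 ^ c)%N.

(* Main.v *)
(** The primes up to [1 + 1 / delta] are found by a linear sieve run on a wheel.
    Let [N] be a power of two between [1 / delta] and [2 / delta], and let
    [M = k!] be the largest factorial with [M ^ 4 <= N] (but at least 2).  A table
    of size [M] lets the program jump from one integer coprime to [M] to the next.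
    In the sieve, every such integer [i] crosses out [p * i] for the primes
    [k < p <= pdiv i]; a composite [y] is thus crossed out once, from its largest
    proper divisor [y %/ pdiv y].  The time is [O(log N + M ^ 2)] plus a constant
    multiple of the number of integers up to [N] coprime to [M], about
    [N * phi M / M].  For [n <= k] the sets [n * {y | y coprime to k!}] are
    disjoint, so that [phi M / M] times the [k]-th harmonic number is at most 1,
    and the time is [o(N)]. *)
Require Import Defs.
From mathcomp Require Import all_boot all_order all_algebra zify lra.
From mathcomp Require Import all_classical all_reals all_analysis.
Import Order.TTheory GRing.Theory Num.Theory.
Import numFieldNormedType.Exports.
Set Implicit Arguments.
Unset Strict Implicit.
Unset Printing Implicit Defensive.
Local Open Scope classical_set_scope.
Local Open Scope ring_scope.
Local Open Scope nat_scope.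

(** * Enumeration of the primes and the prime-counting function *)

Lemma next_primeP n : prime (next_prime n) /\ n < next_prime n.
Proof. by rewrite /next_prime; case: ex_minnP => p /andP[-> ->]. Qed.

Lemma next_prime_le n p : prime p -> n < p -> next_prime n <= p.
Proof.
by move=> pr np; rewrite /next_prime; case: ex_minnP => q _; apply; rewrite np.
Qed.

Lemma nth_prime_prime i : prime (nth_prime i).
Proof. by case: i => //= i; have [] := next_primeP (nth_prime i). Qed.

Lemma ltn_nth_primeS i : nth_prime i < nth_prime i.+1.
Proof. by have [] := next_primeP (nth_prime i). Qed.

Lemma leq_nth_prime : {mono nth_prime : i j / i <= j}.
Proof.
by apply: leq_mono; apply: homo_ltn ltn_nth_primeS => y x z; apply: ltn_trans.
Qed.

Definition primepi n := count prime (iota 0 n).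

Lemma primepiS n : primepi n.+1 = primepi n + prime n.
Proof. by rewrite /primepi -addn1 iotaD count_cat /= addn0. Qed.

Lemma primepi2 : primepi 3 = 1. Proof. by []. Qed.

Lemma leq_primepi n : primepi n <= n.
Proof. by rewrite (leq_trans (count_size _ _)) // size_iota. Qed.

(** The first hypothesis is [ltn_nth_prime] at [n], assumed here so that this fact can serve inside
    the induction that proves it. *)
Lemma nth_primepi_ind n :
  (forall j, (nth_prime j < n) = (j < primepi n)) ->
  prime n -> nth_prime (primepi n) = n.
Proof.
move=> IH pn; apply/eqP; rewrite eqn_leq [n <= _]leqNgt IH ltnn andbT.
case E: (primepi n) => [|m] /=; first exact: prime_gt1.
by apply: next_prime_le => //; rewrite IH E.
Qed.

(** A Galois connection between [nth_prime] and [primepi], through which comparisons of primes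
    become comparisons of indices. *)
Lemma ltn_nth_prime n j : (nth_prime j < n) = (j < primepi n).
Proof.
elim: n j => // n IH j; rewrite primepiS.
case: (boolP (prime n)) => pn; last first.
  rewrite addn0 -IH ltnS leq_eqVlt; case: eqVneq => // e.
  by rewrite -e nth_prime_prime in pn.
by rewrite addn1 !ltnS -{1}(nth_primepi_ind IH pn) leq_nth_prime.
Qed.

Lemma nth_primepi n : prime n -> nth_prime (primepi n) = n.
Proof. by apply: nth_primepi_ind => j; apply: ltn_nth_prime. Qed.

(** * Integers coprime to a factorial and least prime factors *)

Lemma prime_dvd_fact p k : prime p -> (p %| k`!) = (p <= k).
Proof.
move=> pp; apply/idP/idP => [|pk]; last by rewrite dvdn_fact // prime_gt0.
elim: k => [|k IH]; first by rewrite fact0 dvdn1 => /eqP E; rewrite E in pp.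
rewrite factS Euclid_dvdM // => /orP[/dvdn_leq|/IH/leqW //]; exact.
Qed.

Lemma coprime_factP k x :
  reflect (forall p, prime p -> p <= k -> ~~ (p %| x)) (coprime k`! x).
Proof.
apply: (iffP idP) => [co p pp pk|H].
  apply/negP => px; have : p %| gcdn k`! x by rewrite dvdn_gcd px prime_dvd_fact // pk.
  by rewrite (eqP co) dvdn1 => /eqP E; rewrite E in pp.
rewrite /coprime eqn_leq gcdn_gt0 fact_gt0 andbT leqNgt; apply/negP => g1.
have := H _ (pdiv_prime g1); rewrite -(prime_dvd_fact _ (pdiv_prime g1)).
by rewrite !(dvdn_trans (pdiv_dvd _)) ?dvdn_gcdl ?dvdn_gcdr // => /(_ isT).
Qed.

Lemma coprime_fact_pdiv k x : coprime k`! x -> 1 < x -> k < pdiv x.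
Proof.
move=> /coprime_factP H x1; rewrite ltnNge; apply/negP => /(H _ (pdiv_prime x1)).
by rewrite pdiv_dvd.
Qed.

Lemma prime_coprime_gt k q : prime q -> k < q -> coprime k`! q.
Proof.
move=> qp kq; apply/coprime_factP => p pp pk.
by rewrite dvdn_prime2 //; apply/eqP => E; move: kq; rewrite -E ltnNge pk.
Qed.

(** If [k.+1] is coprime to [k!], its least prime factor exceeds [k], hence is [k.+1] itself. The
    equality fails at [k = 0], since 1 is coprime to [0!] without being prime. *)
Lemma prime_coprime_fact k : 0 < k -> prime k.+1 = coprime k`! k.+1.
Proof.
move=> k0; apply/idP/idP => [pk|co]; first exact: prime_coprime_gt.
have := coprime_fact_pdiv co; rewrite !ltnS => /(_ k0) h.
have := pdiv_dvd k.+1 => /dvdn_leq /= => /(_ isT) h2.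
have E : pdiv k.+1 = k.+1 by apply/eqP; rewrite eqn_leq h2 h.
by rewrite -E pdiv_prime.
Qed.

(** The pair [(p, i)] can be read off the product as its least prime factor and cofactor, so
    distinct pairs cross out distinct integers. *)
Lemma pdivM p i : prime p -> 1 < i -> p <= pdiv i -> pdiv (p * i) = p.
Proof.
move=> pp i1 pi; have p1 := prime_gt1 pp.
apply/eqP; rewrite eqn_leq pdiv_min_dvd ?dvdn_mulr //=.
have pi1 : 1 < p * i by rewrite (leq_trans p1) // leq_pmulr // ltnW.
have := pdiv_dvd (p * i); rewrite Euclid_dvdM ?pdiv_prime //.
case/orP => [|d]; first by rewrite dvdn_prime2 ?pdiv_prime // => /eqP ->.
by rewrite (leq_trans pi) // pdiv_min_dvd // prime_gt1 // pdiv_prime.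
Qed.

(** Converse of [pdivM]: every composite [y] is [p * i] for an admissible pair with [i < y], so the
    sieve misses none. *)
Lemma composite_cofactor y : 1 < y -> ~~ prime y ->
  [/\ 1 < y %/ pdiv y, y %/ pdiv y < y & pdiv y <= pdiv (y %/ pdiv y)].
Proof.
move=> y1 npy; have pp := pdiv_prime y1; have p1 := prime_gt1 pp.
have E : y = y %/ pdiv y * pdiv y by rewrite divnK // pdiv_dvd.
have d1 : 1 < y %/ pdiv y.
  case: (y %/ pdiv y) E => [|[|//]] E; first by rewrite E in y1.
  by rewrite E mul1n pp in npy.
split=> //; first by rewrite ltn_Pdiv // ltnW.
apply: pdiv_min_dvd; first exact/prime_gt1/pdiv_prime.
apply: dvdn_trans (pdiv_dvd _) _.
by apply/dvdnP; exists (pdiv y); rewrite mulnC.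
Qed.

(** * Density of the integers coprime to [M] *)

Definition ncoprime M x := count (coprime M) (iota 0 x).

Lemma ncoprime_period M q : ncoprime M (q * M) = q * ncoprime M M.
Proof.
elim: q => [|q IH] //; rewrite mulSn addnC /ncoprime iotaD count_cat -/(ncoprime M _).
rewrite IH mulSn addnC; congr addn; rewrite add0n -[q * M]addn0 iotaDl count_map.
by apply: eq_count => x /=; rewrite /coprime gcdnMDl.
Qed.

Lemma leq_ncoprime M x y : x <= y -> ncoprime M x <= ncoprime M y.
Proof.
move=> xy; rewrite /ncoprime -(subnKC xy) iotaD count_cat; exact: leq_addr.
Qed.

Lemma ncoprime_le M x : ncoprime M x <= x.
Proof. by rewrite (leq_trans (count_size _ _)) // size_iota. Qed.

(** Here [ncoprime M M] is Euler's totient of [M]. The products [n * y], with [n <= k] and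
    [y < M ^ 2 / n] coprime to [M], are distinct integers below [M ^ 2]. As [n] divides [M], the
    range [M ^ 2 / n] is a whole number of periods. *)
Lemma ncoprime_density k : 1 < k ->
  ncoprime k`! k`! * \sum_(1 <= n < k.+1) k`! %/ n <= k`! * k`!.
Proof.
move=> k1; set M := k`!.
pose S := [seq n * y | n <- iota 1 k, y <- [seq y <- iota 0 (M * M %/ n) | coprime M y]].
have dvM n : n \in iota 1 k -> 0 < n /\ n %| M.
  by rewrite mem_iota add1n ltnS => h; rewrite dvdn_fact //; case/andP: h.
have cop0 : ~~ coprime M 0.
  rewrite /coprime gcdn0; apply/eqP => E.
  by have := fact_geq k; rewrite -/M E => /(leq_trans k1).
(* [n] divides [n' * y'] and, as a divisor of [M], is coprime to [y']. By symmetry, equal products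
   force [n = n']. *)
have main n n' y y' : n %| M -> n' %| M -> coprime M y -> coprime M y' ->
    n * y = n' * y' -> n %| n'.
  move=> dn dn' cy cy' E; rewrite -(@Gauss_dvdl n n' y') ?(coprime_dvdl dn) //.
  by rewrite -E dvdn_mulr.
have uS : uniq S.
  apply: allpairs_uniq_dep; first exact: iota_uniq.
    by move=> n _; rewrite filter_uniq // iota_uniq.
  move=> _ _ /allpairsPdep[n [y [/dvM[n0 dn] + ->]]]
    /allpairsPdep[n' [y' [/dvM[n0' dn'] + ->]]] /=.
  rewrite !mem_filter => /andP[cy _] /andP[cy' _] E.
  have En : n = n'.
    by apply/eqP; rewrite eqn_dvd (main n n' y y') // (main n' n y' y).
  by subst n'; move/eqP: E; rewrite eqn_pmul2l // => /eqP ->.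
have sS : {subset S <= iota 0 (M * M)}.
  move=> _ /allpairsPdep[n [y [/dvM[n0 dn] + ->]]].
  rewrite mem_filter !mem_iota !add0n /= => /andP[_ /= h].
  by rewrite mulnC -ltn_divRL // dvdn_mull.
have := uniq_leq_size uS sS; rewrite size_iota; apply: leq_trans.
rewrite size_allpairs_dep sumnE big_map big_distrr /= /index_iota subSS subn0.
rewrite big_seq_cond [leqRHS]big_seq_cond; apply: leq_sum => n /andP[/dvM[n0 dn] _].
by rewrite size_filter -/(ncoprime M _) -divn_mulAC // ncoprime_period mulnC.
Qed.

(** Gives the strict decrease of the counts that measure the remaining work of the sieve. *)
Lemma count_lt (T : eqType) (P Q : pred T) (s : seq T) x :
  x \in s -> (forall y, P y -> Q y) -> Q x -> ~~ P x -> count P s < count Q s.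
Proof.
move=> + PQ Qx nPx; elim: s => //= y s IH; rewrite inE => /orP[/eqP <-|xs].
  by rewrite Qx (negPf nPx) add0n ltnS sub_count.
by rewrite -addnS leq_add ?IH //; case: (P y) (PQ y) => // ->.
Qed.

(** * Memory layout and a program logic that counts time *)

(* A memory whose first cells are the entries of [v]; cell [size v + n] holds [f n]. *)
Fixpoint mem_of (A : Type) (v : seq A) (f : nat -> A) (n : nat) : A :=
  if v is x :: v' then if n is n'.+1 then mem_of v' f n' else x else f n.

Lemma mem_of_nth A (x0 : A) v f n : n < size v -> mem_of v f n = nth x0 v n.
Proof. by elim: v n => [|x v IH] [|n] //= /IH. Qed.

Lemma mem_of_array A (v : seq A) f n : mem_of v f (size v + n) = f n.
Proof. by elim: v. Qed.

Lemma upd_mem_of_scalar A (x0 : A) v f n x : n < size v ->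
  upd (mem_of v f) n x =1 mem_of (set_nth x0 v n x) f.
Proof.
rewrite /upd; elim: v n => [|y v IH] [|n] //= h [|j] //=.
by rewrite eqSS IH.
Qed.

Lemma upd_mem_of_array A (v : seq A) f n x :
  upd (mem_of v f) (size v + n) x =1 mem_of v (upd f n x).
Proof. by rewrite /upd; elim: v => [|y v IH] //= [|j] //=; rewrite addSn eqSS IH. Qed.

(** The final [Skip] takes no time, so a block costs exactly the sum of its parts. *)
Definition block (ps : seq prog) : prog := foldr Seq Skip ps.
Arguments block : simpl never.

Section Logic.
Variables (R : realType) (W : nat).
Implicit Types (s : state R) (Q : nat -> state R -> Prop).
Implicit Types (v : seq nat) (f : nat -> nat) (rv : seq R) (g : nat -> R).

(** Total correctness: an error has no execution, so the existence of a run gives error-free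
    termination; [Q] also sees the time. *)
Definition wp (p : prog) Q s : Prop := exists t s', exec W s p t s' /\ Q t s'.

Lemma wp_impl p Q Q' s : (forall t s', Q t s' -> Q' t s') -> wp p Q s -> wp p Q' s.
Proof. by move=> H [t [s' [e q]]]; exists t, s'; split=> //; apply: H. Qed.

Lemma wp_nil Q s : Q 0 s -> wp (block [::]) Q s.
Proof. by move=> q; exists 0, s; split=> //; constructor. Qed.

Lemma wp_cons p ps Q s :
  wp p (fun t => wp (block ps) (fun u => Q (t + u))) s -> wp (block (p :: ps)) Q s.
Proof.
move=> [t [s1 [e1 [u [s2 [e2 q]]]]]]; exists (t + u), s2; split=> //.
exact: exec_seq e1 e2.
Qed.

Lemma wp_do i Q s s' : run_instr W s i = Some s' -> Q 1 s' -> wp (Do i) Q s.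
Proof. by move=> e q; exists 1, s'; split=> //; constructor. Qed.

Lemma wp_if b c p q Q s : run_test s b = Some c ->
  wp (if c then p else q) (fun t => Q t.+1) s -> wp (If b p q) Q s.
Proof.
by move=> e [t [s' [x y]]]; exists t.+1, s'; split=> //; apply: exec_if e x.
Qed.

(* The first argument of the invariant is the time still available for the
   remaining iterations, which also ensures termination. *)
Lemma wp_while (Inv : nat -> state R -> Prop) b p n s :
  Inv n s ->
  (forall n s, Inv n s -> exists2 c, run_test s b = Some c &
     c -> wp p (fun t s1 => exists2 m, Inv m s1 & t + m < n) s) ->
  wp (While b p) (fun t s' => exists m, [/\ Inv m s', run_test s' b = Some false
    & t + m <= n.+1]) s.
Proof.
move=> I H; elim/ltn_ind: n s I => n IH s I.
have [[] e h] := H n s I; last first.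
  by exists 1, s; split; [exact: exec_while_done | exists n].
have [t [s1 [x [m I1 lt]]]] := h isT.
have [u [s2 [y [m' [I2 e2 le]]]]] := IH m (leq_ltn_trans (leq_addl _ _) lt) s1 I1.
exists (t + u).+1, s2; split; first exact: exec_while_step e x y.
by exists m'; split=> //; lia.
Qed.

(** Integers stay natural until the last subtraction, so contents are kept in [nat]. The lists [v],
    [rv] are the scalar cells, and [f], [g] the arrays that follow them. *)
Definition St v f rv g : state R :=
  State (fun n => Posz (mem_of v f n)) (mem_of rv g).

(** The value 0 for negative constants and indirect cells is a default; [scalar] excludes these
    arguments. *)
Definition val v (x : iarg) : nat :=
  match x with
  | IConst (Posz n) => n
  | ICell (Dir c) => nth 0 v c
  | _ => 0
  end.

Definition scalar v (x : iarg) : bool :=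
  match x with
  | IConst (Posz _) => true
  | ICell (Dir c) => c < size v
  | _ => false
  end.

Lemma iread_St v f rv g x : scalar v x ->
  iread (St v f rv g) x = Some (Posz (val v x)).
Proof.
by case: x => [[]|[]] //= c h; rewrite (mem_of_nth 0).
Qed.

Lemma rread_St v f rv g c : c < size rv ->
  rread (St v f rv g) (Dir c) = Some (nth 0%R rv c).
Proof. by move=> h; rewrite /rread /= (mem_of_nth (0 : R)%R). Qed.

Lemma addr_Ind v f rv g c d j : c < size v -> nth 0 v c = d + j ->
  addr (St v f rv g) (Ind c) = Some (d + j).
Proof. by move=> h e; rewrite /= (mem_of_nth 0) // e. Qed.

Lemma iwrite_St v f rv g c a : c < size v -> a <= W ->
  iwrite W (St v f rv g) (Dir c) (Posz a) = Some (St (set_nth 0 v c a) f rv g).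
Proof.
move=> h ha; rewrite /iwrite ha /=; congr (Some (State _ _)).
by apply: funext => j; rewrite -(upd_mem_of_scalar 0) // /upd; case: eqP.
Qed.

Lemma iwrite_array v f rv g c a j : c < size v -> nth 0 v c = size v + j -> a <= W ->
  iwrite W (St v f rv g) (Ind c) (Posz a) = Some (St v (upd f j a) rv g).
Proof.
move=> h e ha; rewrite /iwrite ha (addr_Ind _ _ _ h e) /=; congr (Some (State _ _)).
apply: funext => i; rewrite -upd_mem_of_array /upd.
by case: eqP.
Qed.

Lemma rwrite_St v f rv g c a : c < size rv ->
  rwrite (St v f rv g) (Dir c) a = Some (St v f (set_nth 0%R rv c a) g).
Proof.
move=> h; rewrite /rwrite /=; congr (Some (State _ _)).
by apply: funext => j; rewrite -(upd_mem_of_scalar (0 : R)%R).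
Qed.

Lemma rwrite_array v f rv g c a j : c < size v -> nth 0 v c = size rv + j ->
  rwrite (St v f rv g) (Ind c) a = Some (St v f rv (upd g j a)).
Proof.
move=> h e; rewrite /rwrite (addr_Ind _ _ _ h e) /=; congr (Some (State _ _)).
by apply: funext => i; rewrite -upd_mem_of_array.
Qed.

Section Steps.
Variables (v : seq nat) (f : nat -> nat) (rv : seq R) (g : nat -> R).
Variables (ps : seq prog) (Q : nat -> state R -> Prop).
Local Notation next v f rv g :=
  (wp (block ps) (fun u => Q u.+1) (St v f rv g)).

Lemma wp_step i s s' : run_instr W s i = Some s' ->
  wp (block ps) (fun u => Q u.+1) s' -> wp (block (Do i :: ps)) Q s.
Proof. by move=> e h; apply: wp_cons; apply: wp_do e _. Qed.

Lemma wp_set c x : [&& c < size v & scalar v x] -> val v x <= W ->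
  next (set_nth 0 v c (val v x)) f rv g ->
  wp (block (Do (ISet (Dir c) x) :: ps)) Q (St v f rv g).
Proof.
move=> /andP[hc hx] hW; apply: wp_step.
by rewrite /run_instr iread_St //= -iwrite_St.
Qed.

Lemma wp_load c d j : [&& c < size v & d < size v] -> nth 0 v d = size v + j ->
  f j <= W ->
  next (set_nth 0 v c (f j)) f rv g ->
  wp (block (Do (ISet (Dir c) (ICell (Ind d))) :: ps)) Q (St v f rv g).
Proof.
move=> /andP[hc hd] e hW; apply: wp_step.
by rewrite /run_instr /iread (addr_Ind _ _ _ hd e) /= mem_of_array -iwrite_St.
Qed.

Lemma wp_store c x j : [&& c < size v & scalar v x] -> nth 0 v c = size v + j ->
  val v x <= W ->
  next v (upd f j (val v x)) rv g ->
  wp (block (Do (ISet (Ind c) x) :: ps)) Q (St v f rv g).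
Proof.
move=> /andP[hc hx] e hW; apply: wp_step.
by rewrite /run_instr iread_St //= (iwrite_array _ _ _ hc e hW).
Qed.

Lemma wp_iop o c x y r : [&& c < size v, scalar v x & scalar v y] ->
  iapply o (Posz (val v x)) (Posz (val v y)) = Some (Posz r) -> r <= W ->
  next (set_nth 0 v c r) f rv g ->
  wp (block (Do (IOp (Dir c) o x y) :: ps)) Q (St v f rv g).
Proof.
move=> /and3P[hc hx hy] e hW; apply: wp_step.
by rewrite /run_instr !iread_St //= e -iwrite_St.
Qed.

Lemma wp_add c x y : [&& c < size v, scalar v x & scalar v y] ->
  val v x + val v y <= W ->
  next (set_nth 0 v c (val v x + val v y)) f rv g ->
  wp (block (Do (IOp (Dir c) IAdd x y) :: ps)) Q (St v f rv g).
Proof. by move=> h; apply: wp_iop. Qed.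

Lemma wp_sub c x y : [&& c < size v, scalar v x & scalar v y] ->
  val v y <= val v x <= W ->
  next (set_nth 0 v c (val v x - val v y)) f rv g ->
  wp (block (Do (IOp (Dir c) ISub x y) :: ps)) Q (St v f rv g).
Proof.
move=> h /andP[le hW]; apply: wp_iop => //=; first by rewrite subzn.
exact: leq_trans (leq_subr _ _) hW.
Qed.

Lemma wp_mul c x y : [&& c < size v, scalar v x & scalar v y] ->
  val v x * val v y <= W ->
  next (set_nth 0 v c (val v x * val v y)) f rv g ->
  wp (block (Do (IOp (Dir c) IMul x y) :: ps)) Q (St v f rv g).
Proof. by move=> h; apply: wp_iop. Qed.

Lemma wp_mod c x y : [&& c < size v, scalar v x & scalar v y] ->
  0 < val v y <= W ->
  next (set_nth 0 v c (val v x %% val v y)) f rv g ->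
  wp (block (Do (IOp (Dir c) IMod x y) :: ps)) Q (St v f rv g).
Proof.
move=> h /andP[gt0 hW]; apply: wp_iop => //=.
  by case: (val v y) gt0 => // n _; rewrite modz_nat.
exact: leq_trans (ltnW (ltn_pmod _ gt0)) hW.
Qed.

Lemma wp_rofint c x : [&& c < size rv & scalar v x] ->
  next v f (set_nth 0%R rv c (val v x)%:R%R) g ->
  wp (block (Do (ROfInt (Dir c) x) :: ps)) Q (St v f rv g).
Proof.
move=> /andP[hc hx]; apply: wp_step.
by rewrite /run_instr iread_St // -rwrite_St.
Qed.

Lemma wp_rofint_array c x j : [&& c < size v & scalar v x] ->
  nth 0 v c = size rv + j ->
  next v f rv (upd g j (val v x)%:R%R) ->
  wp (block (Do (ROfInt (Ind c) x) :: ps)) Q (St v f rv g).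
Proof.
move=> /andP[hc hx] e; apply: wp_step.
by rewrite /run_instr iread_St //= (rwrite_array _ _ _ hc e).
Qed.

Lemma wp_rmul c d e : [&& c < size rv, d < size rv & e < size rv] ->
  next v f (set_nth 0%R rv c (nth 0%R rv d * nth 0%R rv e)%R) g ->
  wp (block (Do (ROp (Dir c) RMul (Dir d) (Dir e)) :: ps)) Q (St v f rv g).
Proof.
move=> /and3P[hc hd he]; apply: wp_step.
by rewrite /run_instr !rread_St // -rwrite_St.
Qed.

Lemma wp_rdiv c d e : [&& c < size rv, d < size rv & e < size rv] ->
  nth 0%R rv e != 0%R ->
  next v f (set_nth 0%R rv c (nth 0%R rv d / nth 0%R rv e)%R) g ->
  wp (block (Do (ROp (Dir c) RDiv (Dir d) (Dir e)) :: ps)) Q (St v f rv g).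
Proof.
move=> /and3P[hc hd he] nz; apply: wp_step.
by rewrite /run_instr !rread_St //= (negPf nz) -rwrite_St.
Qed.

End Steps.

Lemma run_itest_le v f rv g x y : scalar v x && scalar v y ->
  run_test (St v f rv g) (ITest CLe x y) = Some (val v x <= val v y).
Proof. by move=> /andP[hx hy]; rewrite /run_test !iread_St. Qed.

Lemma run_itest_lt v f rv g x y : scalar v x && scalar v y ->
  run_test (St v f rv g) (ITest CLt x y) = Some (val v x < val v y).
Proof. by move=> /andP[hx hy]; rewrite /run_test !iread_St //= ltz_nat. Qed.

Lemma run_itest_eq v f rv g x y : scalar v x && scalar v y ->
  run_test (St v f rv g) (ITest CEq x y) = Some (val v x == val v y).
Proof. by move=> /andP[hx hy]; rewrite /run_test !iread_St. Qed.

Lemma run_rtest_lt v f rv g c d : (c < size rv) && (d < size rv) ->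
  run_test (St v f rv g) (RTest CLt (Dir c) (Dir d)) =
  Some (nth 0%R rv c < nth 0%R rv d)%R.
Proof. by move=> /andP[hc hd]; rewrite /run_test !rread_St. Qed.

Lemma run_rtest_eq_array v f rv g c d j : (c < size v) && (d < size rv) ->
  nth 0 v c = size rv + j ->
  run_test (St v f rv g) (RTest CEq (Ind c) (Dir d)) = Some (g j == nth 0%R rv d).
Proof.
move=> /andP[hc hd] e.
by rewrite /run_test rread_St // /rread (addr_Ind _ _ _ hc e) /= mem_of_array.
Qed.

End Logic.
Arguments St : simpl never.

(* Cell [cCnt] counts the primes found so far.  The integer array holds the gap
   from [r] to the next integer coprime to [M] at index [r < M], and the prime of
   index [j] at index [M + j]; the real array is nonzero at the integers crossed
   out. *)
Local Notation cCnt := 0 (only parsing).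
Local Notation cN := 1 (only parsing).
Local Notation cK := 2 (only parsing).
Local Notation cM := 3 (only parsing).
Local Notation cA := 4 (only parsing).
Local Notation cB := 5 (only parsing).
Local Notation cT := 6 (only parsing).
Local Notation cI := 7 (only parsing).
Local Notation cJ := 8 (only parsing).
Local Notation cM0 := 9 (only parsing).
Local Notation cAd := 10 (only parsing).
Local Notation cP := 11 (only parsing).
Local Notation rDelta := 0 (only parsing).
Local Notation rPi := 1 (only parsing).
Local Notation rX := 2 (only parsing).
Local Notation rOne := 3 (only parsing).
Local Notation rZero := 4 (only parsing).
Local Notation cell c := (ICell (Dir c)) (only parsing).
Local Notation const n := (IConst (Posz n)) (only parsing).

Local Notation "c <-- x" := (Do (ISet (Dir c) x)) (at level 70).
Local Notation "c <-- x [+] y" := (Do (IOp (Dir c) IAdd x y))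
  (at level 70, x at next level).
Local Notation "c <-- x [-] y" := (Do (IOp (Dir c) ISub x y))
  (at level 70, x at next level).
Local Notation "c <-- x [*] y" := (Do (IOp (Dir c) IMul x y))
  (at level 70, x at next level).
Local Notation "c <-- x [mod] y" := (Do (IOp (Dir c) IMod x y))
  (at level 70, x at next level).
Local Notation "r <~~ x" := (Do (ROfInt (Dir r) x)) (at level 70).
Local Notation "r <~~ x [*] y" := (Do (ROp (Dir r) RMul (Dir x) (Dir y)))
  (at level 70, x at next level).
Local Notation "r <~~ x [/] y" := (Do (ROp (Dir r) RDiv (Dir x) (Dir y)))
  (at level 70, x at next level).

(** * Programs of the phases before the sieve: size, wheel, gap table *)

Definition size_prog := block [::
  rOne <~~ const 1; cN <-- const 1; rX <~~ cell cN; rX <~~ rX [*] rDelta;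
  While (RTest CLt (Dir rX) (Dir rOne)) (block [::
    cN <-- cell cN [+] cell cN; rX <~~ cell cN; rX <~~ rX [*] rDelta])].

Definition gcd_prog :=
  While (ITest CLt (const 0) (cell cB)) (block [::
    cT <-- cell cA [mod] cell cB; cA <-- cell cB; cB <-- cell cT]).

Definition add_prime c : seq prog := [::
  rX <~~ cell c; rPi <~~ rPi [*] rX;
  cT <-- cell c [-] const 1; rX <~~ cell cT; rPi <~~ rPi [/] rX;
  cCnt <-- cell cCnt [+] const 1].

(** Leaves the fourth power of [(k + 1)!] in [cT]; the wheel grows while this is at most [N]. *)
Definition next_size : seq prog := [::
  cT <-- cell cK [+] const 1; cT <-- cell cM [*] cell cT;
  cT <-- cell cT [*] cell cT; cT <-- cell cT [*] cell cT].

(* The new [k] is prime iff it is coprime to the old [M = (k - 1)!]. *)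
Definition wheel_prog := block ([::
  cK <-- const 2; cM <-- const 2; cCnt <-- const 1;
  rPi <~~ const 2] ++ next_size ++ [::
  While (ITest CLe (cell cT) (cell cN)) (block ([::
    cK <-- cell cK [+] const 1; cA <-- cell cM; cB <-- cell cK;
    gcd_prog;
    If (ITest CEq (cell cA) (const 1)) (block (add_prime cK)) Skip;
    cM <-- cell cM [*] cell cK] ++ next_size))]).

(** The residues are scanned downwards, [cI] holding the next integer coprime to [M]. [cM0] saves
    the index of the first prime above [k], and 12 is the first address of the integer array. *)
Definition gap_prog := block [::
  cM0 <-- cell cCnt; cI <-- cell cM [+] const 1; cJ <-- cell cM;
  While (ITest CLt (const 0) (cell cJ)) (block [::
    cJ <-- cell cJ [-] const 1;
    cT <-- cell cI [-] cell cJ;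
    cAd <-- cell cJ [+] const 12;
    Do (ISet (Ind cAd) (cell cT));
    cA <-- cell cM; cB <-- cell cJ;
    gcd_prog;
    If (ITest CEq (cell cA) (const 1)) (block [:: cI <-- cell cJ]) Skip])].

(** * Correctness and time of the size search and the wheel *)

Section Phases.
Variables (R : realType) (W : nat).
Implicit Types (Q : nat -> state R -> Prop) (f : nat -> nat) (rv : seq R) (g : nat -> R).

(** [cB] strictly decreases and each pass costs 4. This linear bound is crude, but summed over the
    gap table it stays of order [M ^ 2]. *)
Lemma gcd_progP Q cnt N k M a b t i j m0 ad p f rv g :
  a <= W -> b <= W ->
  (forall t' u, u <= 4 * b + 1 ->
     Q u (St [:: cnt; N; k; M; gcdn a b; 0; t'; i; j; m0; ad; p] f rv g)) ->
  wp W gcd_prog Q (St [:: cnt; N; k; M; a; b; t; i; j; m0; ad; p] f rv g).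
Proof.
move=> ha hb H.
pose Inv n (s : state R) := exists a' b' t', [/\ n = 4 * b', a' <= W, b' <= W,
  gcdn a' b' = gcdn a b &
  s = St [:: cnt; N; k; M; a'; b'; t'; i; j; m0; ad; p] f rv g].
apply: wp_impl; last first.
  apply: (@wp_while _ _ Inv _ _ (4 * b)); first by exists a, b, t.
  move=> _ _ [a' [b' [t' [-> ha' hb' E ->]]]].
  rewrite run_itest_lt //=; exists (0 < b') => // b0.
  apply: wp_mod => //=; first by rewrite b0.
  apply: wp_set => //=; apply: wp_set => //=.
    by rewrite (leq_trans _ hb') // ltnW // ltn_pmod.
  apply: wp_nil; exists (4 * (a' %% b')); last by have := ltn_pmod a' b0; lia.
  exists b', (a' %% b'), (a' %% b'); split=> //.
    by rewrite (leq_trans _ hb') // ltnW // ltn_pmod.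
  by rewrite gcdn_modr gcdnC.
move=> u s [m [[a' [b' [t' [-> ha' hb' E ->]]]]]].
rewrite run_itest_lt //= => -[/negbT]; rewrite -eqn0Ngt => /eqP b0.
by move: E; rewrite b0 gcdn0 => -> le; apply: H; lia.
Qed.

Lemma add_primeP Q c ps cnt N k M a b t i j m0 ad p f delta P x rz g :
  let v t' := [:: cnt; N; k; M; a; b; t'; i; j; m0; ad; p] in
  c < 12 -> c != cT ->
  let q := nth 0 (v t) c in
  1 < q -> q <= W -> cnt < W ->
  wp W (block ps) (fun u => Q (6 + u))
   (St [:: cnt + 1; N; k; M; a; b; q - 1; i; j; m0; ad; p] f
       [:: delta, P * q%:R / (q - 1)%:R, (q - 1)%:R & rz]%R g) ->
  wp W (block (add_prime c ++ ps)) Q (St (v t) f [:: delta, P, x & rz] g).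
Proof.
move=> v c12 cT' q q1 qW cW H; rewrite /add_prime /=.
have Eq : val (v t) (cell c) = q by [].
apply: wp_rofint; first by rewrite /= c12.
apply: wp_rmul => //=.
apply: wp_sub; rewrite ?Eq /= ?c12 //; first by rewrite qW ltnW.
apply: wp_rofint => //=; apply: wp_rdiv => //=.
  by rewrite pnatr_eq0; lia.
by apply: wp_add => //=; rewrite addn1.
Qed.

(** [U] is any integer above [1 / delta]: while the test succeeds, [2 ^ e < U], which bounds the
    words and the number of doublings. If [delta >= 1] the loop stops at [e = 0], where
    [2 ^ e * delta < 2] may fail. *)
Lemma size_progP Q (delta : R) U : (0 < delta)%R -> (1 < U%:R * delta)%R -> 2 * U <= W ->
  (forall e x u, (1 <= (2 ^ e)%:R * delta)%R ->
     e = 0 \/ ((2 ^ e)%:R * delta < 2)%R -> 2 ^ e <= 2 * U -> u <= 4 * e + 5 ->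
     Q u (St [:: 0; 2 ^ e; 0; 0; 0; 0; 0; 0; 0; 0; 0; 0] (fun=> 0)
             [:: delta; 0; x; 1; 0]%R (fun=> 0%R))) ->
  wp W size_prog Q (init_state delta).
Proof.
move=> d0 dU UW H.
have U0 : 0 < U by case: U dU {UW H} => //; rewrite mul0r ltNge ler01.
have -> : init_state delta = St (nseq 12 0) (fun=> 0) [:: delta; 0; 0; 0; 0]%R (fun=> 0%R).
  congr State; apply: funext; do 12?[case=> //].
apply: wp_rofint => //=; apply: wp_set => //=; first lia.
apply: wp_rofint => //=; apply: wp_rmul => //=; apply: wp_cons.
pose Inv n (s : state R) := exists e, [/\ n + 4 * e = 4 * U,
  e = 0 \/ ((2 ^ e)%:R * delta < 2)%R, 2 ^ e <= 2 * U &
  s = St [:: 0; 2 ^ e; 0; 0; 0; 0; 0; 0; 0; 0; 0; 0] (fun=> 0)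
         [:: delta; 0; (2 ^ e)%:R * delta; 1; 0]%R (fun=> 0%R)].
apply: wp_impl; last first.
  apply: (@wp_while _ _ Inv _ _ (4 * U)).
    by exists 0; split=> //; [rewrite muln0 addn0 | left | rewrite expn0; lia].
  move=> n _ [e [En He eU ->]]; rewrite run_rtest_lt //=; eexists => // lt1.
  have lt : 2 ^ e < U.
    by rewrite -(ltr_nat R) -(ltr_pM2r d0); apply: lt_trans dU.
  have := ltn_expl e (isT : 1 < 2) => lte.
  apply: wp_add => //=; first lia.
  apply: wp_rofint => //=; apply: wp_rmul => //=; apply: wp_nil.
  have E2 : 2 ^ e + 2 ^ e = 2 ^ e.+1 by rewrite expnS; lia.
  exists (n - 4); last lia.
  exists e.+1; rewrite -E2; split; [lia| |lia|by []].
  by right; rewrite natrD mulrDl -[X in (_ < X)%R]/(1 + 1)%R ltrD.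
move=> u s [m [[e [Em He eU ->]]]]; rewrite run_rtest_lt //= => -[/negbT].
rewrite -leNgt => ge1 le; apply: wp_nil; apply: H => //; lia.
Qed.

(** The initial wheel [2!] is kept even if its fourth power 16 exceeds [N]; hence the slack 16 in
    later bounds. *)
Definition wheel_ok N k := k = 2 \/ k`! * k`! * (k`! * k`!) <= N.

Lemma wheel_fact_le N k : wheel_ok N k -> k`! * k`! * (k`! * k`!) <= N + 16.
Proof. by case=> [-> | le] //; [rewrite leq_addl | rewrite (leq_trans le) ?leq_addr]. Qed.

(** The fourth power of [(k + 1)!], written as [next_size] computes it. *)
Definition size_test k := let x := k`! * (k + 1) in x * x * (x * x).

(** The machine forms this number even when it exceeds [N], so it must fit in a word. As
    [k + 1 <= 2 * k!], it is at most [16 * k! ^ 8], and [k! ^ 4 <= N + 16]. *)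
Lemma size_test_le N k : 1 < k -> wheel_ok N k ->
  size_test k <= 16 * ((N + 16) * (N + 16)).
Proof.
move=> k1 /wheel_fact_le; rewrite /size_test; have := fact_geq k.
set M := k`!; move=> kM le; set x := M * (k + 1).
have hx : x <= 2 * (M * M) by rewrite mulnCA leq_mul2l; lia.
have hx2 : x * x <= 4 * (M * M * (M * M)).
  by rewrite (leq_trans (leq_mul hx hx)) //; lia.
rewrite (leq_trans (leq_mul hx2 hx2)) //.
by have := leq_mul le le; lia.
Qed.

Lemma prod_prime_ratioS n : prime n ->
  (\prod_(0 <= l < primepi n) prime_ratio R l * n%:R / (n - 1)%:R)%R =
  (\prod_(0 <= l < primepi n + 1) prime_ratio R l)%R.
Proof.
move=> pn; rewrite addn1 big_nat_recr //= /prime_ratio nth_primepi //.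
by rewrite natrB ?prime_gt0 // mulrA.
Qed.

Section Wheel.
Variable N : nat.
Hypothesis HW : 16 * ((N + 16) * (N + 16)) <= W.

Lemma next_sizeP Q ps k cnt a b t i j m0 ad p f rv g : 1 < k -> wheel_ok N k ->
  wp W (block ps) (fun u => Q (4 + u))
   (St [:: cnt; N; k; k`!; a; b; size_test k; i; j; m0; ad; p] f rv g) ->
  wp W (block (next_size ++ ps)) Q
   (St [:: cnt; N; k; k`!; a; b; t; i; j; m0; ad; p] f rv g).
Proof.
move=> k1 ok H; have := size_test_le k1 ok; rewrite /size_test /=.
have k0 := fact_gt0 k; set M := k`! in k0 *; move=> /leq_trans/(_ HW) le.
have le1 : M * (k + 1) <= M * (k + 1) * (M * (k + 1)) by rewrite leq_pmulr; lia.
have le2 : M * (k + 1) * (M * (k + 1)) <= W.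
  by apply: leq_trans le; rewrite leq_pmulr; lia.
have le3 : k + 1 <= M * (k + 1) by rewrite leq_pmull.
apply: wp_add => //=; first lia.
apply: wp_mul => //=; first lia.
by apply: wp_mul => //=; apply: wp_mul.
Qed.

Lemma wheel_progP Q f delta x g :
  (forall k cnt a b t x u, 1 < k -> wheel_ok N k -> N < size_test k ->
     u <= 20 * k * k -> cnt = primepi k.+1 ->
     Q u (St [:: cnt; N; k; k`!; a; b; t; 0; 0; 0; 0; 0] f
             [:: delta; \prod_(0 <= l < cnt) prime_ratio R l; x; 1; 0]%R g)) ->
  wp W wheel_prog Q (St [:: 0; N; 0; 0; 0; 0; 0; 0; 0; 0; 0; 0] f [:: delta; 0; x; 1; 0]%R g).
Proof.
move=> H; rewrite /wheel_prog /=; have W256 : 4096 <= W by apply: leq_trans HW; lia.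
apply: wp_set => //=; first lia.
apply: wp_set => //=; first lia.
apply: wp_set => //=; first lia.
apply: wp_rofint => //=.
apply: (@next_sizeP _ _ 2) => //; first by left.
apply: wp_cons.
(* The potential [20 * k ^ 2] and the time left add up to a constant, large enough because
   [k <= N + 2]. *)
pose Inv n (s : state R) := exists k a b x, [/\ 1 < k, wheel_ok N k,
  n + 20 * k * k = 20 * (N + 2) * (N + 2) &
  s = St [:: primepi k.+1; N; k; k`!; a; b; size_test k; 0; 0; 0; 0; 0] f
         [:: delta; \prod_(0 <= l < primepi k.+1) prime_ratio R l; x; 1; 0]%R g].
apply: wp_impl; last first.
  apply: (@wp_while _ _ Inv _ _ (20 * (N + 2) * (N + 2) - 20 * 2 * 2)).
    exists 2, 0, 0, x; split=> //; [by left| lia|].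
    congr (St _ _ [:: _ ; _ ; _ ; _ ; _] _).
    by rewrite primepi2 big_nat1 /prime_ratio /= -[X in (X - 1)%R]/(1 + 1)%R addrK divr1.
  move=> n _ [k [a [b [y [k1 ok En ->]]]]]; rewrite run_itest_le //=; eexists => // le.
  have k0 := fact_gt0 k; have kM := fact_geq k.
  have leM : (k.+1)`! * (k.+1)`! * ((k.+1)`! * (k.+1)`!) <= N.
    by move: le; rewrite /size_test factS addn1 mulnC.
  have okS : wheel_ok N k.+1 by right.
  have MN : (k.+1)`! <= N.
    by apply: leq_trans leM; rewrite -mulnA leq_pmulr // !muln_gt0 !fact_gt0.
  have kN : k + 1 <= N by rewrite addn1 (leq_trans (fact_geq _)).
  have MN' : k`! <= N by rewrite (leq_trans (leq_fact (leqnSn k))).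
  have NW : 2 * N <= W by apply: leq_trans HW; nia.
  apply: wp_add => //=; first lia.
  apply: wp_set => //=; first lia.
  apply: wp_set => //=; first lia.
  apply: wp_cons; apply: gcd_progP; [lia|lia|] => t u hu.
  rewrite addn1 in kN hu *.
  have cE : (gcdn k`! k.+1 == 1) = prime k.+1 by rewrite (prime_coprime_fact (ltnW k1)).
  have piW : primepi k.+1 < W by apply: leq_ltn_trans (leq_primepi _) _; lia.
  have Epi := primepiS k.+1.
  apply: wp_cons; set s1 := St _ _ _ _.
  have : wp W (If (ITest CEq (cell cA) (const 1)) (block (add_prime cK)) Skip)
    (fun u s => u <= 7 /\ exists t x, s = St [:: primepi k.+2; N; k.+1; k`!;
       gcdn k`! k.+1; 0; t; 0; 0; 0; 0; 0] f
       [:: delta; \prod_(0 <= l < primepi k.+2) prime_ratio R l; x; 1; 0]%R g) s1.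
    apply: wp_if; first by rewrite run_itest_eq.
    rewrite /= cE; case: (boolP (prime k.+1)) => pk; last first.
      exists 0, s1; split; [exact: exec_skip|split=> //].
      by exists t, y; rewrite Epi (negPf pk) addn0.
    rewrite -[add_prime cK]cats0; apply: add_primeP => //=; [lia|lia|].
    apply: wp_nil; split=> //; rewrite prod_prime_ratioS // Epi pk.
    by eexists; eexists.
  apply: wp_impl => v _ [v7 [t1 [x1 ->]]].
  apply: wp_mul => //=; first by rewrite mulnC -factS; lia.
  rewrite mulnC -factS -[next_size]cats0; apply: next_sizeP => //; first lia.
  (* The increase of [20 * k ^ 2]; it pays for the gcd, whose time is linear in [k]. *)
  apply: wp_nil; exists (n - (40 * k + 20)); last nia.
  exists k.+1, (gcdn k`! k.+1), 0, x1; split=> //; [lia|nia].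
move=> u _ [n [[k [a [b [y [k1 ok En ->]]]]]]].
rewrite run_itest_le //= => -[/negbT]; rewrite -ltnNge => lt le.
by apply: wp_nil; apply: H => //; nia.
Qed.

End Wheel.
End Phases.

(** * The table of gaps between integers coprime to [M] *)

Definition gap_ok M r h := [/\ 0 < h, coprime M (r + h), r + h <= M + 1
  & forall d, 0 < d < h -> ~~ coprime M (r + d)].

Section Gap.
Variables (R : realType) (W : nat).
Implicit Types (Q : nat -> state R -> Prop) (f : nat -> nat) (rv : seq R) (g : nat -> R).

(** Throughout, [i] is the least integer [>= j] coprime to [M]. It starts at [M + 1], which is
    coprime to [M]; hence [r + h <= M + 1] in [gap_ok]. The gcd dominates the cost [4 * M + 20] of a
    pass. *)
Lemma gap_progP Q cnt N k M a b t f rv g : 1 < M -> 2 * M + 50 <= W -> cnt <= W ->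
  (forall f' a b t ad u, (forall r, r < M -> gap_ok M r (f' r)) ->
     u <= (4 * M + 20) * M + 4 ->
     Q u (St [:: cnt; N; k; M; a; b; t; 1; 0; cnt; ad; 0] f' rv g)) ->
  wp W gap_prog Q (St [:: cnt; N; k; M; a; b; t; 0; 0; 0; 0; 0] f rv g).
Proof.
move=> M1 MW cW H; rewrite /gap_prog.
apply: wp_set => //=; apply: wp_add => //=; first lia.
apply: wp_set => //=; first lia.
apply: wp_cons.
pose Inv n (s : state R) := exists a b t i j ad f, [/\ n = (4 * M + 20) * j,
  coprime M i /\ j <= M, j <= i <= M + 1,
  (forall x, j <= x < i -> ~~ coprime M x) /\ (forall r, j <= r < M -> gap_ok M r (f r)) &
  s = St [:: cnt; N; k; M; a; b; t; i; j; cnt; ad; 0] f rv g].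
apply: wp_impl; last first.
  apply: (@wp_while _ _ Inv _ _ ((4 * M + 20) * M)).
    exists a, b, t, (M + 1), M, 0, f; split=> //; [by rewrite addn1 coprimenS| lia|].
    split=> [x hx|r]; last lia.
    have -> : x = M by lia.
    by rewrite /coprime gcdnn; lia.
  move=> _ _ [a' [b' [t' [i [j [ad [f' [-> [co jM] /andP[ji iM] [nco gp] ->]]]]]]]].
  rewrite run_itest_lt //=; eexists => // j0.
  apply: wp_sub => //=; first lia.
  apply: wp_sub => //=; first lia.
  apply: wp_add => //=; first lia.
  apply: (wp_store (j := j - 1)) => //=; [lia|lia|].
  apply: wp_set => //=; first lia.
  apply: wp_set => //=; first lia.
  apply: wp_cons; apply: gcd_progP; [lia|lia|] => t1 u hu.
  set f1 := upd _ _ _.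
  have gp1 r : j - 1 <= r < M -> gap_ok M r (f1 r).
    move=> hr; rewrite /f1 /upd; case: eqP => [->|ne]; last by apply: gp; lia.
    split; [lia| by rewrite subnKC //; lia | lia|].
    by move=> d hd; apply: nco; lia.
  apply: wp_cons; apply: wp_if; first by rewrite run_itest_eq.
  rewrite /=; case: (boolP (_ == 1)) => c1.
    apply: wp_set => //=; first lia.
    apply: wp_nil; apply: wp_nil; exists ((4 * M + 20) * (j - 1)); last nia.
    do 7 eexists; split; [by []| |  | |reflexivity]; [by split=> //; lia|lia|].
    by split=> // x; lia.
  exists 0; eexists; split; first exact: exec_skip.
  apply: wp_nil; exists ((4 * M + 20) * (j - 1)); last nia.
  do 7 eexists; split; [by []| |  | |reflexivity]; [by split=> //; lia|lia|].
  split=> // x hx; case: (eqVneq x (j - 1)) => [->|ne]; first exact: c1.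
  by apply: nco; lia.
move=> u _ [n [[a2 [b2 [t2 [i [j [ad [f2 [-> [co jM] /andP[ji iM] [nco gp] ->]]]]]]]]]].
rewrite run_itest_lt //= => -[/negbT]; rewrite -eqn0Ngt => /eqP j0 le.
(* As [M > 1], 0 is not coprime to [M], so the scan ends at 1, where the sieve sets out. *)
have E : i = 1.
  case: i co nco {ji iM} => [|[|i]] co nco //.
    by move: co; rewrite /coprime gcdn0; lia.
  by have := nco 1; rewrite coprimen1; lia.
apply: wp_nil; rewrite j0 E; apply: H; [|lia].
by move=> r rM; apply: gp; lia.
Qed.

End Gap.

(** * The linear sieve and its crossing-out invariant *)

Definition advance : seq prog := [::
  cT <-- cell cI [mod] cell cM; cAd <-- cell cT [+] const 12;
  Do (ISet (Dir cT) (ICell (Ind cAd))); cI <-- cell cI [+] cell cT;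
  cT <-- cell cI [-] const 1; rX <~~ cell cT; rX <~~ rX [*] rDelta].

Definition load_prime : seq prog := [::
  cAd <-- cell cM [+] const 12; cAd <-- cell cAd [+] cell cJ;
  Do (ISet (Dir cP) (ICell (Ind cAd))); cT <-- cell cP [*] cell cI].

(* Setting [cT] to [N + 1] leaves the loop. *)
Definition mark_prog : prog :=
  While (ITest CLe (cell cT) (cell cN)) (block [::
    cAd <-- cell cT [+] const 5; Do (ROfInt (Ind cAd) (const 1));
    cA <-- cell cI [mod] cell cP;
    If (ITest CEq (cell cA) (const 0)) (block [:: cT <-- cell cN [+] const 1])
       (block ([:: cJ <-- cell cJ [+] const 1] ++ load_prime))]).

(** The loop runs while [(i - 1) * delta < 1], which for a prime [i] means
    [i / (i - 1) > 1 + delta]. At the exit [cCnt] is the index [L + 2] of the least prime [>= i].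
    The offsets 12 and 5 are the first addresses of the two arrays. *)
Definition sieve_prog : prog := block (advance ++ [::
  While (RTest CLt (Dir rX) (Dir rOne)) (block ([::
    cAd <-- cell cI [+] const 5;
    If (RTest CEq (Ind cAd) (Dir rZero)) (block ([::
      cAd <-- cell cM [+] const 12; cAd <-- cell cAd [+] cell cCnt;
      Do (ISet (Ind cAd) (cell cI))] ++ add_prime cI)) Skip;
    cJ <-- cell cM0] ++ load_prime ++ [:: mark_prog] ++ advance));
  cCnt <-- cell cCnt [-] const 2; Do (RSet (Dir rDelta) (Dir rPi))]).

(* The integers crossed out are those with cofactor less than [i], and those with
   cofactor [i] whose least prime factor is less than [b]. *)
Definition marks_ok (R : realType) N M i b (g : nat -> R) :=
  forall y, 1 < y <= N -> coprime M y ->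
  (g y != 0%R) = ~~ prime y && ((y %/ pdiv y < i) || (y %/ pdiv y == i) && (pdiv y < b)).

(** Potential of the marking loop: each pass lowers it. *)
Definition unmarked (R : realType) N M (g : nat -> R) :=
  count (fun y => coprime M y && (g y == 0%R)) (iota 0 N.+1).

Definition primes_stored M m0 i f :=
  forall j, m0 <= j < primepi i -> f (M + j) = nth_prime j.

Section Sieve.
Variables (R : realType) (W : nat).
Implicit Types (Q : nat -> state R -> Prop) (f : nat -> nat) (rv : seq R) (g : nat -> R).
Variables (N k : nat).
Hypothesis k1 : 1 < k.
Local Notation M := k`!.
Hypothesis HW : 16 * ((N + 16) * (N + 16)) <= W.
Hypothesis MN : M <= N + 16.

(** Coprimality to [M] has period [M], so the gap stored at [i %% M] leads from [i] to the next
    candidate. *)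
Lemma advanceP Q ps cnt a b t i j m0 ad p f delta P x rz g :
  i <= N -> (forall r, r < M -> gap_ok M r (f r)) ->
  (forall t ad i', i < i' -> i' <= N + M + 1 -> coprime M i' ->
    (forall x, i < x < i' -> ~~ coprime M x) ->
  wp W (block ps) (fun u => Q (7 + u))
   (St [:: cnt; N; k; M; a; b; t; i'; j; m0; ad; p] f
      [:: delta, P, (i' - 1)%:R * delta & rz]%R g)) ->
  wp W (block (advance ++ ps)) Q
   (St [:: cnt; N; k; M; a; b; t; i; j; m0; ad; p] f [:: delta, P, x & rz] g).
Proof.
move=> iN gp H /=; have M0 : 0 < M by apply: fact_gt0.
have rM := ltn_pmod i M0; have [h0 co hM nco] := gp _ rM.
have Ei := divn_eq i M.
have WN : 64 * (N + 16) <= W by apply: leq_trans HW; nia.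
apply: wp_mod => //=; first by rewrite M0; lia.
apply: wp_add => //=; first lia.
apply: (wp_load (j := i %% M)) => //=; [by rewrite addnC | lia |].
apply: wp_add => //=; first lia.
apply: wp_sub => //=; first lia.
apply: wp_rofint => //=; apply: wp_rmul => //=.
have shift d : coprime M (i + d) = coprime M (i %% M + d).
  by rewrite /coprime {1}Ei -addnA gcdnMDl.
apply: H; [lia | lia | by rewrite shift |] => y hy.
by rewrite -(subnKC (ltnW (proj1 (andP hy)))) shift; apply: nco; lia.
Qed.

Lemma load_primeP Q ps cnt a b t i j m0 ad p f rv g q :
  i <= N -> q <= i -> j <= N -> f (M + j) = q ->
  (forall t ad, t = q * i ->
  wp W (block ps) (fun u => Q (4 + u))
   (St [:: cnt; N; k; M; a; b; t; i; j; m0; ad; q] f rv g)) ->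
  wp W (block (load_prime ++ ps)) Q (St [:: cnt; N; k; M; a; b; t; i; j; m0; ad; p] f rv g).
Proof.
move=> iN qi jN E H /=.
have WN : 64 * (N + 16) <= W by apply: leq_trans HW; nia.
apply: wp_add => //=; first lia.
apply: wp_add => //=; first lia.
apply: (wp_load (j := M + j)) => //=; [lia | by rewrite E; lia |].
rewrite E; apply: wp_mul => //=; last exact: H.
by apply: leq_trans HW; nia.
Qed.

(** Least prime factors of integers coprime to [M] are primes above [k], so [b] may cross any
    interval free of such primes. *)
Lemma marks_ok_bound i b b' (g : nat -> R) : marks_ok N M i b g ->
  (forall q, prime q -> k < q -> (q < b) = (q < b')) -> marks_ok N M i b' g.
Proof.
move=> ok H y hy co; have y1 : 1 < y by case/andP: hy.
by rewrite ok // H ?pdiv_prime // coprime_fact_pdiv.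
Qed.

Lemma marks_okS i b (g : nat -> R) : marks_ok N M i b g ->
  (forall y, 1 < y <= N -> ~~ prime y -> y %/ pdiv y = i -> pdiv y < b) ->
  marks_ok N M i.+1 0 g.
Proof.
move=> ok H y hy co; rewrite ok // ltn0 andbF orbF ltnS.
case: (boolP (prime y)) => //= npy.
by case: ltngtP => //= E; rewrite H.
Qed.

(** By [pdivM], only [p * i] has least prime factor [p] and cofactor [i], so a single entry
    changes. *)
Lemma marks_ok_upd i p (g : nat -> R) : 1 < i -> prime p -> p <= pdiv i ->
  marks_ok N M i p g -> marks_ok N M i p.+1 (upd g (p * i) 1%R).
Proof.
move=> i1 pp pi ok y hy co; have y1 : 1 < y by case/andP: hy.
rewrite /upd; case: (eqVneq y (p * i)) => [->|ne].
  rewrite oner_eq0 pdivM // mulKn ?prime_gt0 // eqxx ltnS leqnn orbT andbT.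
  by apply/esym/primePn; right; exists p; rewrite ?dvdn_mulr //;
    rewrite prime_gt1 //= ltn_Pmulr // prime_gt0.
rewrite ok // ltnS [pdiv y <= p]leq_eqVlt; case: eqP => //= e1.
by case: eqP => //= e2; case/eqP: ne; rewrite -e1 -e2 mulnC divnK // pdiv_dvd.
Qed.

Lemma unmarked_upd y (g : nat -> R) : y <= N -> coprime M y -> g y = 0%R ->
  unmarked N M (upd g y 1%R) < unmarked N M g.
Proof.
move=> yN co g0; apply: (@count_lt _ _ _ _ y); first by rewrite mem_iota.
- by move=> x /andP[-> /=]; rewrite /upd; case: (x == y) => //; rewrite oner_eq0.
- by rewrite co g0 eqxx.
- by rewrite /upd eqxx oner_eq0 andbF.
Qed.

Lemma ltn_prime_nth q j : prime q -> (q < nth_prime j) = (primepi q < j).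
Proof.
move=> pq; rewrite -{1}(nth_primepi pq) !ltnNge; congr (~~ _).
exact: leq_nth_prime.
Qed.

Lemma nth_prime_gt j : primepi k.+1 <= j -> k < nth_prime j.
Proof. by rewrite leqNgt -ltn_nth_prime ltnS -ltnNge. Qed.

Lemma nth_prime_le_pdiv i : 1 < i -> coprime M i ->
  nth_prime (primepi k.+1) <= pdiv i.
Proof.
move=> i1 co; have pi := pdiv_prime i1; rewrite leqNgt ltn_prime_nth //.
by rewrite -ltn_nth_prime nth_primepi // ltnS -ltnNge coprime_fact_pdiv.
Qed.

(** Amortized bound: every pass crosses out a fresh integer and is paid by the drop of
    [10 * unmarked]; the extra 1 is the final test. *)
Lemma mark_progP Q i cnt a b ad f rv (g : nat -> R) :
  let m0 := primepi k.+1 in size rv = 5 ->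
  1 < i <= N -> coprime M i -> primes_stored M m0 i.+1 f -> marks_ok N M i 0 g ->
  (forall a b t j ad p g' u, marks_ok N M i.+1 0 g' ->
     u + 10 * unmarked N M g' <= 10 * unmarked N M g + 1 ->
     Q u (St [:: cnt; N; k; M; a; b; t; i; j; m0; ad; p] f rv g')) ->
  wp W mark_prog Q
    (St [:: cnt; N; k; M; a; b; nth_prime m0 * i; i; m0; m0; ad; nth_prime m0] f rv g).
Proof.
move=> m0 rv5 /andP[i1 iN] co st ok H.
have WN : 64 * (N + 16) <= W by apply: leq_trans HW; nia.
have pi : prime (pdiv i) by apply: pdiv_prime.
have ki := coprime_fact_pdiv co i1.
have pii : pdiv i <= i by apply: pdiv_leq; lia.
(* Either [p] is the next prime to use, or [p = pdiv i] has been used and [t = N + 1] forces the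
   exit. *)
pose Inv n (s : state R) := exists a b t j ad p g, [/\ n = 10 * unmarked N M g,
  s = St [:: cnt; N; k; M; a; b; t; i; j; m0; ad; p] f rv g &
  [/\ p = nth_prime j, m0 <= j < primepi i.+1, p <= pdiv i, t = p * i & marks_ok N M i p g]
  \/ t = N + 1 /\ marks_ok N M i (pdiv i).+1 g].
apply: wp_impl; last first.
  apply: (@wp_while _ _ Inv _ _ (10 * unmarked N M g)).
    exists a, b, (nth_prime m0 * i), m0, ad, (nth_prime m0), g; split=> //; left.
    have m0i : nth_prime m0 <= pdiv i by apply: nth_prime_le_pdiv.
    split=> //.
      by rewrite leqnn -ltn_nth_prime ltnS (leq_trans m0i).
    apply: marks_ok_bound ok _ => q pq kq; rewrite ltn0; apply/esym/negbTE.
    by rewrite ltn_prime_nth // -ltn_nth_prime nth_primepi // ltnS -ltnNge.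
  move=> _ _ [a' [b' [t [j [ad' [p [g' [-> -> C]]]]]]]].
  rewrite run_itest_le //=; eexists => // tN.
  case: C => [[Ep hj ppi Et ok']|[Et _]]; last lia.
  have pp : prime p by rewrite Ep nth_prime_prime.
  have kp : k < p by rewrite Ep nth_prime_gt //; lia.
  have cop : coprime M (p * i) by rewrite coprimeMr co andbT prime_coprime_gt.
  have t1 : 1 < t by rewrite Et; have := prime_gt1 pp; nia.
  (* [t] has cofactor [i] and least prime factor [p], which is not below the bound [p]: it is not
     crossed out yet. *)
  have gt : g' t = 0%R.
    apply/eqP; have := ok' t; rewrite t1 tN Et => /(_ isT cop).
    rewrite pdivM // mulKn ?prime_gt0 // eqxx !ltnn /= andbF => /negbT.
    by rewrite negbK.
  apply: wp_add => //=; first lia.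
  apply: (wp_rofint_array (j := t)) => //=; first by rewrite rv5 addnC.
  apply: wp_mod => //=; first by rewrite prime_gt0 //=; lia.
  have ok1 : marks_ok N M i p.+1 (upd g' t 1%R) by rewrite Et; apply: marks_ok_upd.
  have lt1 : unmarked N M (upd g' t 1%R) < unmarked N M g'.
    by apply: unmarked_upd; rewrite // Et.
  rewrite /= -[(1%:R)%R]/(1%R : R); set g1 := upd _ _ _ in ok1 lt1 *.
  apply: wp_cons; apply: wp_if; first by rewrite run_itest_eq.
  rewrite /=; case: (boolP (_ == 0)) => dv.
    apply: wp_add => //=; first lia.
    apply: wp_nil; apply: wp_nil; exists (10 * unmarked N M g1); last lia.
    do 7 eexists; split; [reflexivity|reflexivity|]; right; split=> //.
    have -> // : pdiv i = p.
    by apply/eqP; rewrite eqn_leq ppi andbT pdiv_min_dvd // prime_gt1.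
  have pi' : p < pdiv i.
    rewrite ltn_neqAle ppi andbT; apply: contraNneq dv => ->.
    exact: pdiv_dvd.
  (* The next prime is at most [pdiv i <= i], hence already in the table. *)
  have le1 : nth_prime j.+1 <= pdiv i.
    by apply: next_prime_le => //; rewrite -/(nth_prime j) -Ep.
  have lej : j.+1 < primepi i.+1 by rewrite -ltn_nth_prime ltnS (leq_trans le1).
  have jN : j.+1 <= N by have := leq_primepi i.+1; lia.
  apply: wp_add => //=; first lia.
  rewrite -[load_prime]cats0.
  apply: (@load_primeP _ _ _ _ _ _ _ _ _ _ _ _ _ _ (nth_prime j.+1)) => //.
  - exact: leq_trans le1 pii.
  - by rewrite addn1.
  - by rewrite addn1 st //; lia.
  move=> t2 ad2 Et2; apply: wp_nil; apply: wp_nil.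
  exists (10 * unmarked N M g1); last lia.
  do 7 eexists; split; [reflexivity|reflexivity|]; left; split=> //.
  - by rewrite addn1.
  - by rewrite addn1; lia.
  apply: marks_ok_bound ok1 _ => q pq kq.
  by rewrite ltnS Ep [RHS]ltn_prime_nth // ltnS -[RHS]leq_nth_prime nth_primepi.
move=> u _ [n [[a' [b' [t [j [ad' [p [g' [-> -> C]]]]]]]]]].
rewrite run_itest_le //= => -[/negbT]; rewrite -ltnNge => lt le.
apply: H; last lia.
(* If [p * i > N], any [y <= N] with cofactor [i] has [pdiv y < p]. After the forced exit,
   [composite_cofactor] gives [pdiv y <= pdiv i]. *)
case: C => [[Ep hj ppi Et ok']|[Et ok']]; apply: marks_okS ok' _ => y hy npy E.
  have := divnK (pdiv_dvd y); rewrite E => Ey.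
  by rewrite -(ltn_pmul2r (ltnW i1)) -Et [pdiv y * i]mulnC Ey; lia.
have [] := @composite_cofactor y; [lia|by []|by rewrite E].
Qed.

End Sieve.

(** * The outer loop of the sieve *)

Lemma primepi_eq a b : a <= b -> (forall q, prime q -> a <= q < b -> False) ->
  primepi b = primepi a.
Proof.
move=> ab H; rewrite /primepi -(subnKC ab) iotaD count_cat add0n.
rewrite -[RHS]addn0; congr addn; apply/eqP; rewrite -leqn0 leqNgt -has_count.
apply/hasPn => q; rewrite mem_iota subnKC // => hq; apply/negP => pq.
exact: H hq.
Qed.

Section Main.
Variables (R : realType) (W : nat).
Variables (N k : nat).
Hypothesis k1 : 1 < k.
Local Notation M := k`!.
Hypothesis HW : 16 * ((N + 16) * (N + 16)) <= W.
Hypothesis MN : M <= N + 16.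
Implicit Types (Q : nat -> state R -> Prop) (f : nat -> nat) (g : nat -> R).

(** Potential of the outer loop: the candidates still to be visited. *)
Definition candidates_from i :=
  count (fun y => coprime M y && (i <= y)) (iota 0 N.+1).

Lemma candidates_from_lt i i' : i < i' -> i <= N -> coprime M i ->
  candidates_from i' < candidates_from i.
Proof.
move=> ii iN co; apply: (@count_lt _ _ _ _ i); first by rewrite mem_iota.
- by move=> y /andP[-> /=]; apply: leq_trans; apply: ltnW.
- by rewrite co leqnn.
- by rewrite co -ltnNge.
Qed.

Lemma candidate_gt i : 1 < i -> coprime M i -> k < i.
Proof.
by move=> i1 co; apply: leq_trans (coprime_fact_pdiv co i1) (pdiv_leq _); apply: ltnW.
Qed.

Lemma no_prime_gap i i' q : (forall x, i < x < i' -> ~~ coprime M x) ->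
  prime q -> k < q -> i < q < i' -> False.
Proof. by move=> H pq kq /H; rewrite prime_coprime_gt. Qed.

Lemma coprime_cofactor y : 1 < y -> coprime M y -> coprime M (y %/ pdiv y).
Proof.
move=> y1; rewrite -{1}(divnK (pdiv_dvd y)) coprimeMr; by case/andP.
Qed.

(** A cofactor of an integer coprime to [M] is coprime to [M], so the skipped integers are not
    cofactors of any candidate. *)
Lemma marks_ok_skip i i' (g : nat -> R) : i < i' ->
  (forall x, i < x < i' -> ~~ coprime M x) ->
  marks_ok N M i.+1 0 g -> marks_ok N M i' 0 g.
Proof.
move=> ii H ok y hy co; rewrite ok // !ltn0 !andbF !orbF; congr (_ && _).
have c := coprime_cofactor (proj1 (andP hy)) co.
apply/idP/idP; first by move=> /leq_trans; apply.
move=> lt; rewrite ltnS leqNgt; apply/negP => lt2.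
by have := H (y %/ pdiv y); rewrite lt lt2 c => /(_ isT).
Qed.

Lemma marks_ok_init i' : 1 < i' ->
  (forall x, 1 < x < i' -> ~~ coprime M x) ->
  marks_ok N M i' 0 (fun=> 0%R : R).
Proof.
move=> i1 H; apply: (@marks_ok_skip 1) => // y hy co.
rewrite eqxx !ltn0 !andbF !orbF; case: (boolP (prime y)) => //= npy.
have [] := @composite_cofactor y; [by case/andP: hy|by []|].
by move=> h _ _; apply/esym/negbTE; rewrite -leqNgt.
Qed.

(** No prime below [i] can have index [L + 2]. The prime 2 is exempt: its index 0 would mean
    [n = -2], below the range [n >= -1]. *)
Definition small_primes (delta : R) i := forall q, prime q -> q < i ->
  q = 2 \/ ((q - 1)%:R * delta < 1)%R.

(** Each candidate costs at most 30 outside marking, each crossing-out 10. Both potentials start at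
    no more than [ncoprime M N.+1], whence the factor 40. *)
Lemma sieve_progP Q delta a b t ad f x : (0 < delta)%R ->
  (1 <= N%:R * delta)%R -> small_primes delta k.+1 ->
  let m0 := primepi k.+1 in
  (forall r, r < M -> gap_ok M r (f r)) ->
  (forall i u s, 2 < i -> (1 <= (i - 1)%:R * delta)%R -> small_primes delta i ->
    imem s 0 = ((primepi i)%:Z - 2)%R ->
    rmem s 0 = (\prod_(0 <= l < primepi i) prime_ratio R l)%R ->
    u <= 40 * ncoprime M N.+1 + 20 -> Q u s) ->
  wp W sieve_prog Q (St [:: m0; N; k; M; a; b; t; 1; 0; m0; ad; 0] f
    [:: delta; \prod_(0 <= l < m0) prime_ratio R l; x; 1; 0]%R (fun=> 0%R)).
Proof.
move=> d0 Nd sm m0 gp H.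
have N1 : 0 < N by case: (N) Nd => //; rewrite mul0r ler10.
have WN : 64 * (N + 16) <= W by apply: leq_trans HW; nia.
pose Inv n (s : state R) := exists i a b t j ad p f g,
 [/\ n = 30 * candidates_from i + 10 * unmarked N M g,
  [/\ 1 < i, coprime M i & i <= N + M + 1],
  (forall r, r < M -> gap_ok M r (f r)) /\ primes_stored M m0 i f,
  marks_ok N M i 0 g /\ small_primes delta i &
  s = St [:: primepi i; N; k; M; a; b; t; i; j; m0; ad; p] f
    [:: delta; \prod_(0 <= l < primepi i) prime_ratio R l; (i - 1)%:R * delta; 1; 0]%R g].
rewrite /sieve_prog; apply: (advanceP k1 HW MN) => // t1 ad1 i i1 iN coi nco.
have ki := candidate_gt i1 coi.
have nop q : prime q -> k < q < i -> False.
  move=> pq /andP[kq qi]; apply: (no_prime_gap nco pq kq).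
  by rewrite prime_gt1.
(* [i] is the least integer above 1 coprime to [M], so no prime lies strictly between [k] and
   [i]. *)
have Epi : primepi i = m0 by apply: primepi_eq => //; exact: nop.
apply: wp_cons; apply: wp_impl; last first.
  apply: (@wp_while _ _ Inv _ _ (30 * candidates_from i + 10 * unmarked N M (fun=> 0%R : R))).
    exists i, a, b, t1, 0, ad1, 0, f, (fun=> 0%R); split=> //.
    - by split=> // j; rewrite Epi; lia.
    - split; first exact: marks_ok_init.
      move=> q pq qi; apply: sm => //; rewrite ltnS leqNgt; apply/negP => kq.
      by have := nop q pq; rewrite kq qi => /(_ isT).
    - by rewrite Epi.
  move=> {i i1 iN coi nco ki nop Epi a b t t1 ad ad1 f gp} _ _
    [i [a [b [t [j [ad [p [f [g [-> [i1 coi iNM] [gp st] [ok smi] ->]]]]]]]]]].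
  rewrite run_rtest_lt //=; eexists => // lt1.
  (* The loop test and the choice of [N] give [(i - 1) * delta < 1 <= N * delta]. *)
  have iN : i <= N.
    have : ((i - 1)%:R < N%:R :> R)%R by rewrite -(ltr_pM2r d0); apply: lt_le_trans Nd.
    by rewrite ltr_nat; lia.
  have ki := candidate_gt i1 coi.
  have cntN : primepi i <= N by apply: leq_trans (leq_primepi _) iN.
  apply: wp_add => //=; first lia.
  (* A composite [i] has a cofactor below [i], so it has been crossed out already. *)
  have gE : (g i == 0%R) = prime i.
    have := ok i; rewrite i1 iN coi => /(_ isT isT) /(congr1 negb).
    rewrite negbK => ->; case: (boolP (prime i)) => //= npi.
    by have [_ -> _] := composite_cofactor i1 npi.
  apply: wp_cons; set s1 := St _ _ _ _.
  have : wp W (If (RTest CEq (Ind cAd) (Dir rZero)) (block ([::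
      cAd <-- cell cM [+] const 12; cAd <-- cell cAd [+] cell cCnt;
      Do (ISet (Ind cAd) (cell cI))] ++ add_prime cI)) Skip)
    (fun u s => u <= 10 /\ exists t ad x f,
      [/\ (forall r, r < M -> gap_ok M r (f r)), primes_stored M m0 i.+1 f &
       s = St [:: primepi i.+1; N; k; M; a; b; t; i; j; m0; ad; p] f
       [:: delta; \prod_(0 <= l < primepi i.+1) prime_ratio R l; x; 1; 0]%R g]) s1.
    apply: wp_if.
      by apply: (@run_rtest_eq_array _ _ _ _ _ _ _ i) => //=; rewrite addnC.
    rewrite /= gE; have Epi := primepiS i; case: (boolP (prime i)) => pi; last first.
      exists 0, s1; split; [exact: exec_skip|split=> //].
      exists t, (i + 5), ((i - 1)%:R * delta)%R, f; split=> //.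
        by move=> l; rewrite Epi (negPf pi) addn0; apply: st.
      by rewrite Epi (negPf pi) addn0.
    apply: wp_add => //=; first lia.
    apply: wp_add => //=; first lia.
    apply: (wp_store (j := M + primepi i)) => //=; [lia|lia|].
    rewrite -[add_prime cI]cats0; apply: add_primeP => //=; [lia|lia|].
    apply: wp_nil; split=> //; rewrite prod_prime_ratioS // Epi pi.
    do 4 eexists; split; [| |reflexivity].
      by move=> r rM; rewrite /upd; case: eqP => [E|_]; [lia | exact: gp].
    move=> l; rewrite Epi pi => hl; rewrite /upd eqn_add2l.
    case: eqP => [->|ne]; first by rewrite nth_primepi.
    by apply: st; lia.
  apply: wp_impl => u0 _ [hu0 [t1 [ad1 [x1 [f1 [gp1 st1 ->]]]]]].
  have lep := nth_prime_le_pdiv i1 coi; have pii : pdiv i <= i by apply: pdiv_leq; lia.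
  have m0i : m0 < primepi i.+1 by rewrite -ltn_nth_prime ltnS (leq_trans lep).
  have piS : primepi i.+1 <= N.+1 by rewrite (leq_trans (leq_primepi _)).
  apply: wp_set => //=; first lia.
  apply: (@load_primeP _ _ _ _ k1 HW MN _ _ _ _ _ _ _ _ _ _ _ _ _ _ (nth_prime m0)) => //.
  - exact: leq_trans lep pii.
  - by lia.
  - by apply: st1; rewrite leqnn.
  move=> t2 ad2 ->; apply: wp_cons; apply: (mark_progP k1 HW MN) => //.
    by rewrite i1.
  move=> a3 b3 t3 j3 ad3 p3 g3 u3 ok3 hu3.
  rewrite -[advance]cats0; apply: (advanceP k1 HW MN) => // t4 ad4 i' ii iN' coi' nco.
  have nop q : prime q -> k < q -> i < q < i' -> False by apply: no_prime_gap.
  have Epi : primepi i' = primepi i.+1.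
    apply: primepi_eq => // q pq /andP[iq qi]; apply: (nop q pq); last by rewrite iq.
    exact: ltn_trans ki iq.
  have ltc := candidates_from_lt ii iN coi.
  apply: wp_nil; exists (30 * candidates_from i' + 10 * unmarked N M g3); last lia.
  exists i', a3, b3, t4, j3, ad4, p3, f1, g3; split=> //.
  - by split=> //; lia.
  - by split=> // l; rewrite Epi; apply: st1.
  - split; first exact: marks_ok_skip ok3.
    move=> q pq qi'; case: (ltngtP q i) => [|iq|->]; [exact: smi| |by right].
    by case: (nop q pq) => //; [exact: ltn_trans ki iq | rewrite iq].
  - by rewrite Epi.
move=> u _ [n [[i' [a' [b' [t' [j [ad' [p [f' [g [-> [i1' co' iN'] _ [_ sm'] ->]]]]]]]]]]]].
rewrite run_rtest_lt //= => -[/negbT]; rewrite -leNgt => ge1 le.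
set s0 := St _ _ _ _.
(* The result may be [-1], so the state leaves the form [St]. *)
have e1 : run_instr W s0 (IOp (Dir cCnt) ISub (cell cCnt) (const 2)) =
   Some (State (upd (imem s0) 0 ((primepi i')%:Z - 2)%R) (rmem s0)).
  rewrite /run_instr /s0 !iread_St //= /iwrite ifT //.
  have := leq_primepi i'; lia.
apply: (wp_step e1).
apply: (@wp_step _ _ _ _ _ _ (State (upd (imem s0) 0 ((primepi i')%:Z - 2)%R)
   (upd (rmem s0) 0 (\prod_(0 <= l < primepi i') prime_ratio R l)%R))); first by [].
apply: wp_nil; apply: (H i') => //; first exact: leq_ltn_trans k1 (candidate_gt i1' co').
have hc : candidates_from i <= ncoprime M N.+1.
  by apply: sub_count => y /andP[].
have hu : unmarked N M (fun=> 0%R : R) <= ncoprime M N.+1.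
  by apply: sub_count => y /andP[].
by lia.
Qed.

End Main.

(** * From the final state to [L] and [Psi] *)

Section Assembly.
Variable (R : realType).
Implicit Type delta : R.

Lemma prime_ratio_le (delta : R) j :
  (prime_ratio R j <= 1 + delta)%R = (1 <= (nth_prime j - 1)%:R * delta)%R.
Proof.
have p1 := prime_gt1 (nth_prime_prime j).
rewrite /prime_ratio natrB; last exact: ltnW.
have h : (0 < (nth_prime j)%:R - 1 :> R)%R by rewrite subr_gt0 ltr1n.
by rewrite ler_pdivrMr //; apply/idP/idP; lra.
Qed.

(** The prime of index [primepi i] is at least [i], so it passes the test, while smaller odd primes
    fail it; [i] itself may be composite. *)
Lemma is_L_primepi delta i : 2 < i -> (0 < delta)%R ->
  (1 <= (i - 1)%:R * delta)%R -> small_primes delta i ->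
  is_L delta ((primepi i)%:Z - 2)%R.
Proof.
move=> i2 d0 ge1 sm.
have pi0 : 0 < primepi i by rewrite -ltn_nth_prime.
split; first split; first lia.
  rewrite subrK absz_nat prime_ratio_le; apply: le_trans ge1 _.
  rewrite ler_pM2r // ler_nat leq_sub2r // leqNgt ltn_nth_prime ltnn //.
move=> n [n1]; rewrite prime_ratio_le => adm.
rewrite leNgt; apply/negP => lt.
have mi : `|(n + 2)%R|%N < primepi i by lia.
have m0 : 0 < `|(n + 2)%R|%N by lia.
rewrite -ltn_nth_prime in mi.
(* The prime 2 is impossible here, since [n >= -1] makes the index [n + 2] positive. *)
case: (sm _ (nth_prime_prime _) mi) => [E|]; last by rewrite ltNge adm.
have : nth_prime 0 < nth_prime `|(n + 2)%R| by rewrite ltnNge leq_nth_prime -ltnNge.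
by rewrite E.
Qed.

Lemma Psi_primepi i :
  Psi R ((primepi i)%:Z - 2)%R = (\prod_(0 <= l < primepi i) prime_ratio R l)%R.
Proof. by rewrite /Psi subrK absz_nat. Qed.

Definition main_prog := block [:: size_prog; wheel_prog; gap_prog; sieve_prog].

(** With [N = 2 ^ e]: the size search and constants, the wheel and gap table, the sieve. *)
Definition cost e k :=
  (4 * e + 40) + 50 * (k`! * k`!) + 40 * ncoprime k`! (2 ^ e).+1.

Lemma main_progP W delta U : (0 < delta)%R -> (1 < U%:R * delta)%R ->
  16 * ((2 * U + 16) * (2 * U + 16)) <= W ->
  exists e k u L s,
   [/\ [/\ 1 < k, wheel_ok (2 ^ e) k & 2 ^ e < size_test k],
       (1 <= (2 ^ e)%:R * delta)%R, e = 0 \/ ((2 ^ e)%:R * delta < 2)%R,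
       u <= cost e k &
      [/\ is_L delta L, exec W (init_state delta) main_prog u s,
             imem s 0%N = L
           & rmem s 0%N = Psi R L]].
Proof.
move=> d0 dU HW.
suff [u [s [ex [e [k [L [h1 h2 h3 h4 [h5 h6 h7]]]]]]]] : wp W main_prog (fun u s => exists e k L,
   [/\ [/\ 1 < k, wheel_ok (2 ^ e) k & 2 ^ e < size_test k],
       (1 <= (2 ^ e)%:R * delta)%R, e = 0 \/ ((2 ^ e)%:R * delta < 2)%R,
       u <= cost e k &
      [/\ is_L delta L, imem s 0%N = L & rmem s 0%N = Psi R L]]) (init_state delta).
  by exists e, k, u, L, s.
apply: wp_cons; apply: (size_progP d0 dU); first by apply: leq_trans HW; nia.
move=> e x u Ne He NU hu; apply: wp_cons.
have HWN : 16 * ((2 ^ e + 16) * (2 ^ e + 16)) <= W.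
  by apply: leq_trans HW; rewrite leq_mul2l leq_mul // leq_add2r.
apply: wheel_progP => // k cnt a b t x1 u1 k1 ok lt hu1 Ecnt.
have M4 := wheel_fact_le ok; have M0 := fact_gt0 k; have kM := fact_geq k.
have MN : k`! <= 2 ^ e + 16.
  by apply: leq_trans M4; rewrite -mulnA leq_pmulr // !muln_gt0 M0.
have WN : 64 * (2 ^ e + 16) <= W by apply: leq_trans HWN; nia.
have cW : cnt <= W by rewrite Ecnt; have := leq_primepi k.+1; lia.
apply: wp_cons; apply: gap_progP => //; [lia|lia|].
move=> f a1 b1 t1 ad u2 gp hu2; apply: wp_cons; rewrite Ecnt.
(* For an odd prime [q <= k], [2 * (q - 1) <= k! ^ 4 <= N] and [N * delta < 2]. *)
have sm : small_primes delta k.+1.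
  move=> q pq; rewrite ltnS => qk; case: (eqVneq q 2) => [->|q2]; [by left|right].
  have q2' : 2 < q by have := prime_gt1 pq; lia.
  case: ok => [E|ok]; first lia.
  have N2 : 2 * (q - 1) <= 2 ^ e.
    apply: leq_trans ok; rewrite (@leq_trans (k`! * k`!)) //; first nia.
    by rewrite leq_pmulr // muln_gt0 M0.
  case: He => [E|He]; first by rewrite E in N2; lia.
  rewrite -(ler_nat R) natrM in N2.
  have : ((q - 1)%:R * delta * 2 < 2)%R.
    apply: le_lt_trans He; rewrite mulrAC ler_pM2r // mulrC //.
  lra.
apply: (sieve_progP k1 HWN MN) => // i u3 s i2 ge1 smi Hi Hr hu3.
apply: wp_nil; exists e, k, ((primepi i)%:Z - 2)%R; split=> //.
  by rewrite /cost; nia.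
split=> //; first exact: is_L_primepi.
by rewrite Psi_primepi.
Qed.

(** * The cost is [o(2 ^ e)] *)

Lemma size_test_homo k K : k <= K -> size_test k <= size_test K.
Proof.
move=> kK; have h : k`! * (k + 1) <= K`! * (K + 1) by rewrite leq_mul ?leq_fact ?leq_add2r.
by apply: leq_mul; apply: leq_mul.
Qed.

Lemma sqr_le_expn2 e : e * e <= 4 * 2 ^ e.
Proof.
elim: e => // e IH; case: (ltnP e 3) => [|e3]; first by case: e IH => [|[|[|]]].
by rewrite expnS; nia.
Qed.

Lemma harmonic_ge (A : R) : exists K, forall k, K <= k -> (A <= series harmonic k)%R.
Proof.
have nd : {homo series (@harmonic R) : n m / n <= m >-> (n <= m)%R}.
  apply/nondecreasing_seqP => n; rewrite seriesEnat /= big_nat_recr //= lerDl.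
  exact: harmonic_ge0.
have /cvgryPge/(_ A) [K _ HK] := nondecreasing_dvgn_lt nd (@dvg_harmonic R).
by exists K => k Kk; apply: HK.
Qed.

(** [ncoprime_density] divided by [k!]; [series harmonic k] is the [k]-th harmonic number. *)
Lemma ncoprime_harmonic k : 1 < k ->
  ((ncoprime k`! k`!)%:R * series harmonic k <= k`!%:R :> R)%R.
Proof.
move=> k1; have := ncoprime_density k1; set M := k`!; set c := ncoprime _ _.
have M0 : (0 < M%:R :> R)%R by rewrite ltr0n fact_gt0.
rewrite -(ler_nat R) !natrM natr_sum => le; rewrite -(ler_pM2r M0).
apply: le_trans le; rewrite -mulrA ler_wpM2l //.
rewrite seriesEnat /= mulr_suml big_add1 /=; apply: ler_sum_nat => n /andP[_ nk].
have [q Eq] : exists q, M = q * n.+1 by apply/dvdnP; rewrite dvdn_fact.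
by rewrite Eq mulnK // natrM mulrCA mulVf ?mulr1 // pnatr_eq0.
Qed.

(** The interval is covered by [N %/ M + 1] periods, and a period contains at most [M]
    candidates. *)
Lemma ncoprime_leS k N :
  ncoprime k`! N.+1 * k`! <= N * ncoprime k`! k`! + k`! * k`!.
Proof.
have M0 := fact_gt0 k; set M := k`!.
have h : ncoprime M N.+1 <= (N %/ M).+1 * ncoprime M M.
  by rewrite -ncoprime_period leq_ncoprime // ltn_ceil.
have := leq_divM N M; have := ncoprime_le M M; nia.
Qed.

(** The constant is [306 = 176 + 50 + 40 * 2]. *)
Lemma cost_combine (A : R) n x y z : (A * x%:R <= 176 * n%:R)%R ->
  (A * y%:R <= n%:R)%R -> (A * z%:R <= 2 * n%:R)%R ->
  (A * (x + 50 * y + 40 * z)%N%:R <= 306 * n%:R)%R.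
Proof.
move=> hx hy hz; rewrite (natrD _ (x + 50 * y)) (natrD _ x) (natrM _ 50) (natrM _ 40).
lra.
Qed.

(** Each term of the cost is a bounded multiple of [N / A] once [e], [k] and the harmonic number all
    reach [A]. *)
Lemma cost_little (eps : R) : (0 < eps)%R -> exists E, forall e k, E <= e ->
  1 < k -> wheel_ok (2 ^ e) k -> 2 ^ e < size_test k ->
  ((cost e k)%:R <= eps * (2 ^ e)%:R)%R.
Proof.
move=> eps0; pose A := (306 / eps)%R.
have A0 : (0 < A)%R by rewrite divr_gt0.
have [K HK] := harmonic_ge A.
pose B := (Num.truncn A).+1.
have AB : (A < B%:R)%R by exact: truncnS_gt.
(* Beyond [K'] the harmonic number and [k] reach [A], and [k = 2] is excluded. Since [size_test K'
   <= E <= e < 2 ^ e < size_test k], a large [e] forces [k > K']. *)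
pose K' := K + B + 3; pose E := B + size_test K'.
exists E => e k Ee k1 ok lt.
have kK : K' < k.
  rewrite ltnNge; apply/negP => /size_test_homo le.
  have := ltn_expl e (isT : 1 < 2); rewrite /E in Ee; lia.
have Be : B <= e by rewrite /E in Ee; lia.
have Ae : (A <= e%:R)%R by rewrite (le_trans (ltW AB)) // ler_nat.
have Ak : (A <= k%:R)%R by rewrite (le_trans (ltW AB)) // ler_nat; rewrite /K' in kK; lia.
have AH : (A <= series harmonic k)%R by apply: HK; rewrite /K' in kK; lia.
have M4 : k`! * k`! * (k`! * k`!) <= 2 ^ e by case: ok => // E2; rewrite E2 /K' in kK; lia.
have M0 := fact_gt0 k; have kM := fact_geq k.
set M := k`! in M0 kM M4 *; set N := 2 ^ e in M4 *.
(* [e <= e ^ 2 <= 4 * N], and [176 = 4 * 4 + 40 * 4]. *)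
have X1 : (4 * e + 40) * e <= 176 * N.
  have := sqr_le_expn2 e; rewrite -/N; have : 0 < e by apply: leq_trans Be.
  by clear; nia.
have X2 : M * M * k <= N.
  apply: leq_trans M4; rewrite leq_mul2l; apply/orP; right.
  by rewrite (leq_trans kM) // leq_pmulr.
have X3 := ncoprime_leS k N; rewrite -/M in X3.
have X4 := ncoprime_harmonic k1; rewrite -/M in X4.
rewrite /cost -/M -/N.
set phi := ncoprime M M in X3 X4; set nc := ncoprime M N.+1 in X3 *.
have Mr : (0 < M%:R :> R)%R by rewrite ltr0n.
have Y1 : (A * (4 * e + 40)%:R <= 176 * N%:R)%R.
  rewrite -(ler_nat R) !natrM in X1; apply: le_trans X1.
  by rewrite mulrC ler_wpM2l.
have Y2 : (A * (M * M)%:R <= N%:R)%R.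
  rewrite -(ler_nat R) natrM in X2; apply: le_trans X2.
  by rewrite mulrC ler_wpM2l.
have Y3 : (A * phi%:R <= M%:R)%R.
  by apply: le_trans X4; rewrite mulrC ler_wpM2l.
have Y4 : (A * nc%:R <= 2 * N%:R)%R.
  rewrite -(ler_pM2r Mr); rewrite -(ler_nat R) natrD !natrM in X3.
  have Y5 := ler_wpM2l (ltW A0) X3.
  have Y6 : (A * (N%:R * phi%:R) <= N%:R * M%:R)%R by rewrite mulrCA ler_wpM2l.
  have Y7 : (A * (M%:R * M%:R) <= N%:R * M%:R)%R.
    rewrite -natrM (le_trans Y2) // ler_peMr // ler1n //.
  by move: Y5; rewrite mulrDr; lra.
rewrite -(ler_pM2l A0) mulrA /A divfK; last exact: lt0r_neq0.
exact: cost_combine.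
Qed.

(** As [U >= 1], [4 * (2 * U + 16) <= 72 * U]; squaring gives the constant [72 * 72]. *)
Lemma word_bound_ge c delta U : 72 * 72 <= c -> 1 < c ->
  U = (Num.truncn delta^-1).+1 ->
  16 * ((2 * U + 16) * (2 * U + 16)) <= word_bound c delta.
Proof.
move=> c72 c1 EU; rewrite /word_bound -EU.
have h : 4 * (2 * U + 16) <= 72 * U by lia.
apply: (@leq_trans (72 * 72 * (U * U))).
  by rewrite -[16]/(4 * 4) mulnACA [leqRHS]mulnACA leq_mul.
by apply: leq_mul => //; rewrite mulnn leq_pexp2l // EU.
Qed.

End Assembly.

Local Close Scope nat_scope.

Theorem theorem1p7 (R : realType) :
  exists (P : prog) (c : nat) (T : R -> nat),
    (forall delta : R, 0 < delta ->
       exists (L : int) (s : state R),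
         [/\ is_L delta L,
             exec (word_bound c delta) (init_state delta) P (T delta) s,
             imem s 0%N = L
           & rmem s 0%N = Psi R L])
    /\ (fun delta : R => (T delta)%:R : R) =o_ (0^'+) (fun delta : R => delta^-1).
Proof.
have [c [c72 c1]] : exists c, (72 * 72 <= c)%N /\ (1 < c)%N.
  by exists (72 * 72)%N; rewrite leqnn.
exists main_prog, c.
(* The time is quantified before the hypothesis [0 < delta], so that choice yields a total [T]. *)
have run delta : exists u, 0 < delta -> exists e k L s,
   [/\ [/\ (1 < k)%N, wheel_ok (2 ^ e) k & (2 ^ e < size_test k)%N],
       1 <= (2 ^ e)%:R * delta, e = 0%N \/ (2 ^ e)%:R * delta < 2,
       (u <= cost e k)%N &
      [/\ is_L delta L, exec (word_bound c delta) (init_state delta) main_prog u s,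
             imem s 0%N = L
           & rmem s 0%N = Psi R L]].
  have [d0|nd] := boolP (0 < delta); last by exists 0%N.
  have dU : 1 < (Num.truncn delta^-1).+1%:R * delta.
    by rewrite -ltr_pdivrMr // div1r truncnS_gt.
  have [|e [k [u [L [s h]]]]] := @main_progP R (word_bound c delta) delta _ d0 dU.
    exact: word_bound_ge.
  by exists u => _; exists e, k, L, s.
have [T HT] := choice run; exists T; split=> [delta d0|].
  by have [e [k [L [s [_ _ _ _ h]]]]] := HT _ d0; exists L, s.
apply/eqoP => eps eps0.
(* Half of [eps] suffices because [2 ^ e < 2 / delta]. *)
have [E HE] := cost_little (divr_gt0 eps0 (ltr0n R 2)).
have E0 : 0 < (2 ^ E)%:R^-1 :> R by rewrite invr_gt0 ltr0n expn_gt0.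
near=> delta.
have d0 : 0 < delta by near: delta; exact: nbhs_right_gt.
have dE : delta < (2 ^ E)%:R^-1 by near: delta; exact: nbhs_right_lt.
have {}dE : (2 ^ E)%:R * delta < 1.
  by rewrite -ltr_pdivlMl ?mulr1 // ltr0n expn_gt0.
have [e [k [L [s [[k1 ok lt] Ne He le _]]]]] := HT _ d0.
(* [2 ^ E * delta < 1 <= 2 ^ e * delta]; this also excludes the case [e = 0]. *)
have Ee : (E < e)%N.
  rewrite ltnNge; apply/negP => eE; move: (lt_le_trans dE Ne).
  by rewrite ltr_pM2r // ltr_nat ltn_exp2l // ltnNge eE.
have N2 : (2 ^ e)%:R * delta < 2 by case: He => // e0; rewrite e0 in Ee.
rewrite normr_nat ger0_norm ?invr_ge0 ?(ltW d0) //.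
have := HE e k (ltnW Ee) k1 ok lt; move: le; rewrite -(ler_nat R) => le1 le2.
apply: le_trans (le_trans le1 le2) _.
rewrite -mulrA ler_pM2l // mulrC ler_pdivrMr ?ltr0n //.
by rewrite [leRHS]mulrC ler_pdivlMr // ltW.
Unshelve. all: by end_near.
Qed.
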